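(* Let $\{\Phi_t\}_{t\ge0}$ be a continuous semigroup in the class $\mathcal{G}$ whose elements $\Phi_t$, $t>0$, are not automorphisms of $\mathbb{C}_+$. Then the semigroup is of zero hyperbolic step.
   Context: For $\theta\in\mathbb{R}$, $\mathbb{C}_\theta=\{s\in\mathbb{C}:\operatorname{Re}(s)>\theta\}$ and $\mathbb{C}_+=\mathbb{C}_0$. $\mathcal{D}$ denotes the space of Dirichlet series $\sum_{n\ge1}a_nn^{-s}$ that converge in some half-plane $\mathbb{C}_\theta$; a holomorphic function on a half-plane belongs to $\mathcal{D}$ if it coincides with such a convergent series on some half-plane. Gordon-Hedenmalm class $\mathcal{G}$: an analytic $\Phi:\mathbb{C}_+\to\mathbb{C}_+$ belongs to $\mathcal{G}$ if there are $c_\Phi\in\mathbb{N}\cup\{0\}$ and $\varphi\in\mathcal{D}$ such that $\Phi(s)=c_\Phi s+\varphi(s)$ for $s\in\mathbb{C}_+$, and, in case $c_\Phi=0$, moreover $\Phi(\mathbb{C}_+)\subset\mathbb{C}_{1/2}$. A continuous semigroup in $\mathcal{G}$ is a family $\{\Phi_t\}_{t\ge0}\subset\mathcal{G}$ with $\Phi_0(s)=s$, $\Phi_t\circ\Phi_u=\Phi_{t+u}$ for all $t,u\ge0$, and $\Phi_t\to\Phi_0$ uniformly on compact subsets of $\mathbb{C}_+$ as $t\to0^+$. For a continuous semigroup in $\mathbb{C}_+$, if $\Phi_{t_0}$ is an automorphism for one $t_0>0$ then every $\Phi_t$ is an automorphism. Let $\omega$ be the hyperbolic distance in $\mathbb{C}_+$.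 A continuous semigroup with no fixed points in $\mathbb{C}_+$ is of positive hyperbolic step if there is $s_0\in\mathbb{C}_+$ such that $\lim_{t\to+\infty}\omega(\Phi_t(s_0),\Phi_{t+1}(s_0))>0$ (and then this holds at every point of $\mathbb{C}_+$). Otherwise it is of zero hyperbolic step. *)

(* Defs.v *)
From Stdlib Require Import Reals List.
From Coquelicot Require Import Coquelicot.
Open Scope R_scope.

(* Functions are total on [C]; on a half-plane only the values there matter,
   and [half_plane 0] is the right half-plane. *)
Definition half_plane (theta : R) (s : C) : Prop := theta < Re s.

Definition holomorphic_on (U : C -> Prop) (f : C -> C) : Prop :=
  forall z : C, U z -> ex_derive (K := C_AbsRing) (V := C_NormedModule) f z.

Definition maps_into (U V : C -> Prop) (f : C -> C) : Prop :=
  forall z : C, U z -> V (f z).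

(* Coquelicot has no complex exponential. *)
Definition Cexp (z : C) : C :=
  (exp (Re z) * cos (Im z), exp (Re z) * sin (Im z)).

(* n^{-s}, meaningful for n >= 1. *)
Definition nat_cpow_opp (n : nat) (s : C) : C :=
  Cexp (- (s * RtoC (ln (INR n))))%C.

(* [is_series] sums from 0, hence the shift; [a 0] is not used. *)
Definition is_dirichlet_sum (a : nat -> C) (s l : C) : Prop :=
  is_series (K := C_AbsRing) (V := C_NormedModule)
    (fun n : nat => (a (S n) * nat_cpow_opp (S n) s)%C) l.

Definition in_dirichlet_class (eta : R) (f : C -> C) : Prop :=
  holomorphic_on (half_plane eta) f /\
  exists (a : nat -> C) (theta : R),
    eta <= theta /\
    forall s : C, half_plane theta s -> is_dirichlet_sum a s (f s).

Definition gordon_hedenmalm (Phi : C -> C) : Prop :=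
  holomorphic_on (half_plane 0) Phi /\
  maps_into (half_plane 0) (half_plane 0) Phi /\
  exists (c : nat) (phi : C -> C),
    in_dirichlet_class 0 phi /\
    (forall s : C, half_plane 0 s -> Phi s = (RtoC (INR c) * s + phi s)%C) /\
    (c = 0%nat -> maps_into (half_plane 0) (half_plane (1 / 2)) Phi).

(* Stdlib's [compact] is only about subsets of [R]. *)
Definition compact_set (K : C -> Prop) : Prop :=
  forall (I : Type) (U : I -> C -> Prop),
    (forall i : I, open (U i)) ->
    (forall z : C, K z -> exists i : I, U i z) ->
    exists l : list I, forall z : C, K z -> exists i : I, In i l /\ U i z.

Definition continuous_semigroup_in_G (Phi : R -> C -> C) : Prop :=
  (forall t : R, 0 <= t -> gordon_hedenmalm (Phi t)) /\
  (forall s : C, half_plane 0 s -> Phi 0 s = s) /\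
  (forall t u : R, 0 <= t -> 0 <= u ->
     forall s : C, half_plane 0 s -> Phi t (Phi u s) = Phi (t + u) s) /\
  (forall K : C -> Prop, compact_set K -> (forall s : C, K s -> half_plane 0 s) ->
     forall eps : R, 0 < eps ->
     exists delta : R, 0 < delta /\
       forall t : R, 0 < t < delta ->
       forall s : C, K s -> Cmod (Phi t s - Phi 0 s) < eps).

Definition automorphism (f : C -> C) : Prop :=
  holomorphic_on (half_plane 0) f /\
  maps_into (half_plane 0) (half_plane 0) f /\
  exists g : C -> C,
    holomorphic_on (half_plane 0) g /\
    maps_into (half_plane 0) (half_plane 0) g /\
    (forall z : C, half_plane 0 z -> g (f z) = z) /\
    (forall z : C, half_plane 0 z -> f (g z) = z).

(* Normalised as the transport of the disc distance
   (1/2) ln ((1 + |z|) / (1 - |z|)) from 0 to z. *)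
Definition hyperbolic_dist (z w : C) : R :=
  let rho := Cmod (z - w) / Cmod (z + Cconj w) in
  / 2 * ln ((1 + rho) / (1 - rho)).

(* A fixed point of a semigroup is a point fixed by all its elements. *)
Definition no_fixed_points (Phi : R -> C -> C) : Prop :=
  forall s : C, half_plane 0 s -> ~ (forall t : R, 0 <= t -> Phi t s = s).

Definition positive_hyperbolic_step (Phi : R -> C -> C) : Prop :=
  no_fixed_points Phi /\
  exists (s0 : C) (l : R),
    half_plane 0 s0 /\ 0 < l /\
    is_lim (fun t : R => hyperbolic_dist (Phi t s0) (Phi (t + 1) s0))
      p_infty l.

Definition zero_hyperbolic_step (Phi : R -> C -> C) : Prop :=
  no_fixed_points Phi /\ ~ positive_hyperbolic_step Phi.

(* Main.v *)
Require Import Defs.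
From Stdlib Require Import Reals Lra Lia Classical ClassicalEpsilon.
From Coquelicot Require Import Coquelicot.
Open Scope R_scope.

(* At infinity [Phi_t(s) = c_t s + O(1)], the [c_t] are multiplicative in [t], and
   [c_t >= 1] for small [t], so [c_1 = c_(1/n)^n] for all large [n] forces [c_1 = 1]:
   [Phi_1(s) = s + phi(s)].  For [f] holomorphic with [Re f >= 0] on the half-plane,
   Harnack makes [Re f(x + iy) / x] nonincreasing and [x Re f(x + iy)]
   nondecreasing in [x].  The first fact applied to [Phi_1] gives [Re phi >= 0]; since
   [phi = a_1 + O(x^-2)], the second one shows that [Re a_1 = 0] would make [Re phi]
   vanish and [Phi_1] a translation, an automorphism.  Hence [Re a_1 > 0], and the
   first fact applied to [phi] bounds [Re phi] below on each [Re s >= x_0 > 0].  So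
   there is no fixed point, [Re Phi_n(s_0)] grows linearly while [phi] stays
   bounded along the orbit, and the pseudohyperbolic steps tend to 0.

   Harnack comes from [|Re f'(z)| Re z <= Re f(z)], obtained by transporting the
   mean value property to the disc; the latter needs only Goursat's theorem, in
   the variable [log w]. *)

(** * The divergence theorem on rectangles, without continuity of the derivatives *)

(** Outward flux of the field $(U,-V)$ through the boundary of $[a,b]\times[c,d]$. For $F=U+iV$ it
    is the imaginary part of the counterclockwise contour integral of $F$. *)
Definition box_flux (U V : R -> R -> R) (a b c d : R) : R :=
  RInt (fun y => U b y - U a y) c d - RInt (fun x => V x d - V x c) a b.

(** The shared [p] is the Cauchy-Riemann equation $U_x=V_y$: the field $(U,-V)$ has divergence zero
    at the point. Only differentiability at that point is asked, as in Goursat's theorem. *)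
Definition balanced_at (U V : R -> R -> R) (x y : R) : Prop :=
  exists p qU qV : R,
    differentiable_pt_lim U x y p qU /\ differentiable_pt_lim V x y qV p.

Lemma differentiable_pt_lim_continuous_x (f : R -> R -> R) (x y lx ly : R) :
  differentiable_pt_lim f x y lx ly -> continuous (fun u => f u y) x.
Proof.
  intros H.
  apply (ex_derive_continuous (K := R_AbsRing) (V := R_NormedModule)).
  exists (lx * 1 + ly * 0). apply is_derive_Reals.
  apply (derivable_pt_lim_comp_2d f (fun u => u) (fun _ => y) x lx ly 1 0).
  - exact H.
  - apply derivable_pt_lim_id.
  - apply derivable_pt_lim_const.
Qed.

Lemma differentiable_pt_lim_continuous_y (f : R -> R -> R) (x y lx ly : R) :
  differentiable_pt_lim f x y lx ly -> continuous (fun v => f x v) y.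
Proof.
  intros H.
  apply (ex_derive_continuous (K := R_AbsRing) (V := R_NormedModule)).
  exists (lx * 0 + ly * 1). apply is_derive_Reals.
  apply (derivable_pt_lim_comp_2d f (fun _ => x) (fun v => v) y lx ly 0 1).
  - exact H.
  - apply derivable_pt_lim_const.
  - apply derivable_pt_lim_id.
Qed.

Section Flux.

Variables U V : R -> R -> R.

Let balanced_on (a b c d : R) : Prop :=
  forall x y, a <= x <= b -> c <= y <= d -> balanced_at U V x y.

Lemma balanced_ex_RInt_U (a b c d x : R) :
  balanced_on a b c d -> a <= x <= b -> c <= d -> ex_RInt (fun y => U x y) c d.
Proof.
  intros H Hx Hcd. apply (ex_RInt_continuous (V := R_CompleteNormedModule)).
  intros y. rewrite Rmin_left, Rmax_right by lra. intros Hy.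
  destruct (H x y Hx Hy) as (p & qU & qV & HU & _).
  exact (differentiable_pt_lim_continuous_y _ _ _ _ _ HU).
Qed.

Lemma balanced_ex_RInt_V (a b c d y : R) :
  balanced_on a b c d -> c <= y <= d -> a <= b -> ex_RInt (fun x => V x y) a b.
Proof.
  intros H Hy Hab. apply (ex_RInt_continuous (V := R_CompleteNormedModule)).
  intros x. rewrite Rmin_left, Rmax_right by lra. intros Hx.
  destruct (H x y Hx Hy) as (p & qU & qV & _ & HV).
  exact (differentiable_pt_lim_continuous_x _ _ _ _ _ HV).
Qed.

Lemma box_flux_sub (a b c d a' b' c' d' : R) :
  balanced_on a b c d -> a <= a' -> a' <= b' -> b' <= b -> c <= c' -> c' <= d' -> d' <= d ->
  box_flux U V a' b' c' d' =
    RInt (fun y => U b' y) c' d' - RInt (fun y => U a' y) c' d'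
    - (RInt (fun x => V x d') a' b' - RInt (fun x => V x c') a' b').
Proof.
  intros H H1 H2 H3 H4 H5 H6.
  assert (H' : balanced_on a' b' c' d').
  { intros x y Hx Hy. apply H; lra. }
  unfold box_flux.
  rewrite (RInt_minus (V := R_CompleteNormedModule) (fun y => U b' y) (fun y => U a' y)).
  - rewrite (RInt_minus (V := R_CompleteNormedModule) (fun x => V x d') (fun x => V x c')).
    + reflexivity.
    + apply (balanced_ex_RInt_V a' b' c' d'); auto; lra.
    + apply (balanced_ex_RInt_V a' b' c' d'); auto; lra.
  - apply (balanced_ex_RInt_U a' b' c' d'); auto; lra.
  - apply (balanced_ex_RInt_U a' b' c' d'); auto; lra.
Qed.

(** Each interior edge belongs to two neighbouring boxes with opposite signs, so its contributions
    cancel. *)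
Lemma box_flux_split (a m b c n d : R) :
  balanced_on a b c d -> a <= m <= b -> c <= n <= d ->
  box_flux U V a b c d =
    box_flux U V a m c n + box_flux U V m b c n
    + box_flux U V a m n d + box_flux U V m b n d.
Proof.
  intros H Hm Hn.
  rewrite !(box_flux_sub a b c d) by (auto; lra).
  assert (HU : forall x, a <= x <= b ->
    RInt (fun y => U x y) c d = RInt (fun y => U x y) c n + RInt (fun y => U x y) n d).
  { intros x Hx. symmetry.
    apply (RInt_Chasles (V := R_CompleteNormedModule) (fun y => U x y) c n d).
    - apply (balanced_ex_RInt_U a b c n); try lra. intros u v Hu Hv. apply H; lra.
    - apply (balanced_ex_RInt_U a b n d); try lra. intros u v Hu Hv. apply H; lra. }
  assert (HV : forall y, c <= y <= d ->
    RInt (fun x => V x y) a b = RInt (fun x => V x y) a m + RInt (fun x => V x y) m b).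
  { intros y Hy. symmetry.
    apply (RInt_Chasles (V := R_CompleteNormedModule) (fun x => V x y) a m b).
    - apply (balanced_ex_RInt_V a m c d); try lra. intros u v Hu Hv. apply H; lra.
    - apply (balanced_ex_RInt_V m b c d); try lra. intros u v Hu Hv. apply H; lra. }
  rewrite (HU a), (HU b), (HV c), (HV d) by lra. ring.
Qed.

(* Linear parts cancel in the flux because both fields have the same [p]. *)
Lemma box_flux_small (x y eps : R) :
  balanced_at U V x y -> 0 < eps ->
  exists delta : R, 0 < delta /\
    forall a b c d : R, balanced_on a b c d ->
      a <= x <= b -> c <= y <= d -> b - a < delta -> d - c < delta ->
      Rabs (box_flux U V a b c d) <= eps * ((b - a) + (d - c)) ^ 2.
Proof.
  intros (p & qU & qV & HU & HV) He.
  destruct (HU (mkposreal (eps / 2) ltac:(lra))) as [d1 H1].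
  destruct (HV (mkposreal (eps / 2) ltac:(lra))) as [d2 H2].
  exists (Rmin d1 d2). split.
  { apply Rmin_pos; apply cond_pos. }
  intros a b c d Hbal Hx Hy Hab Hcd.
  pose proof (Rmin_l d1 d2). pose proof (Rmin_r d1 d2).
  set (L := (b - a) + (d - c)).
  assert (BU : forall u v, a <= u <= b -> c <= v <= d ->
    Rabs (U u v - U x y - (p * (u - x) + qU * (v - y))) <= eps / 2 * L).
  { intros u v Hu Hv. eapply Rle_trans.
    - apply H1; apply Rabs_def1; lra.
    - simpl. apply Rmult_le_compat_l; [lra|].
      apply Rmax_lub; apply Rabs_le; unfold L; lra. }
  assert (BV : forall u v, a <= u <= b -> c <= v <= d ->
    Rabs (V u v - V x y - (qV * (u - x) + p * (v - y))) <= eps / 2 * L).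
  { intros u v Hu Hv. eapply Rle_trans.
    - apply H2; apply Rabs_def1; lra.
    - simpl. apply Rmult_le_compat_l; [lra|].
      apply Rmax_lub; apply Rabs_le; unfold L; lra. }
  assert (EU : ex_RInt (fun v => U b v - U a v) c d).
  { apply (ex_RInt_minus (V := R_CompleteNormedModule));
    apply (balanced_ex_RInt_U a b c d); auto; lra. }
  assert (EV : ex_RInt (fun u => V u d - V u c) a b).
  { apply (ex_RInt_minus (V := R_CompleteNormedModule));
    apply (balanced_ex_RInt_V a b c d); auto; lra. }
  assert (IU : RInt (fun v => U b v - U a v - p * (b - a)) c d
    = RInt (fun v => U b v - U a v) c d - (d - c) * (p * (b - a))).
  { rewrite (RInt_minus (V := R_CompleteNormedModule) (fun v => U b v - U a v)
      (fun _ => p * (b - a))); auto.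
    - rewrite RInt_const. reflexivity.
    - apply ex_RInt_const. }
  assert (IV : RInt (fun u => V u d - V u c - p * (d - c)) a b
    = RInt (fun u => V u d - V u c) a b - (b - a) * (p * (d - c))).
  { rewrite (RInt_minus (V := R_CompleteNormedModule) (fun u => V u d - V u c)
      (fun _ => p * (d - c))); auto.
    - rewrite RInt_const. reflexivity.
    - apply ex_RInt_const. }
  (* The terms in [qU] agree on the two vertical edges and cancel, which leaves two errors of size
     [eps / 2 * L]. *)
  assert (AU : Rabs (RInt (fun v => U b v - U a v - p * (b - a)) c d)
     <= (d - c) * (eps * L)).
  { apply abs_RInt_le_const; [lra| |].
    - apply (ex_RInt_minus (V := R_CompleteNormedModule)); auto. apply ex_RInt_const.
    - intros v Hv. pose proof (BU b v ltac:(lra) Hv) as B1.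
      pose proof (BU a v ltac:(lra) Hv) as B2.
      apply Rabs_le_between in B1. apply Rabs_le_between in B2.
      apply Rabs_le. lra. }
  assert (AV : Rabs (RInt (fun u => V u d - V u c - p * (d - c)) a b)
     <= (b - a) * (eps * L)).
  { apply abs_RInt_le_const; [lra| |].
    - apply (ex_RInt_minus (V := R_CompleteNormedModule)); auto. apply ex_RInt_const.
    - intros u Hu. pose proof (BV u d Hu ltac:(lra)) as B1.
      pose proof (BV u c Hu ltac:(lra)) as B2.
      apply Rabs_le_between in B1. apply Rabs_le_between in B2.
      apply Rabs_le. lra. }
  rewrite IU in AU. rewrite IV in AV. unfold box_flux.
  apply Rabs_le_between in AU. apply Rabs_le_between in AV.
  apply Rabs_le. unfold L in *. nra.
Qed.

(** Goursat's bisection: a nonzero flux [J] would give nested quarter boxes of flux at least $J/4^n$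
    shrinking to a point, where [box_flux_small] makes the flux smaller than that. *)
Lemma box_flux_zero (a b c d : R) :
  a <= b -> c <= d -> balanced_on a b c d -> box_flux U V a b c d = 0.
Proof.
  intros Hab Hcd Hbal.
  apply NNPP. intros Hne.
  set (J := Rabs (box_flux U V a b c d)).
  assert (HJ : 0 < J) by (apply Rabs_pos_lt; exact Hne).
  set (w := fun n : nat => (b - a) / 2 ^ n).
  set (h := fun n : nat => (d - c) / 2 ^ n).
  (* [p] is the lower left corner of a box of generation [n] that has kept its share of the flux. *)
  set (bad := fun (n : nat) (p : R * R) =>
    a <= fst p /\ fst p + w n <= b /\ c <= snd p /\ snd p + h n <= d /\
    J / 4 ^ n <= Rabs (box_flux U V (fst p) (fst p + w n) (snd p) (snd p + h n))).
  assert (Hw : forall n, w n = w (S n) + w (S n)).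
  { intros n. unfold w. simpl. field. apply pow_nonzero. lra. }
  assert (Hh : forall n, h n = h (S n) + h (S n)).
  { intros n. unfold h. simpl. field. apply pow_nonzero. lra. }
  assert (Hw0 : forall n, 0 <= w n).
  { intros n. unfold w. apply Rdiv_le_0_compat; [lra|apply pow_lt; lra]. }
  assert (Hh0 : forall n, 0 <= h n).
  { intros n. unfold h. apply Rdiv_le_0_compat; [lra|apply pow_lt; lra]. }
  assert (step : forall n p, bad n p -> exists q, bad (S n) q /\
     fst p <= fst q /\ snd p <= snd q /\
     fst q + w (S n) <= fst p + w n /\ snd q + h (S n) <= snd p + h n).
  { intros n [x y] (B1 & B2 & B3 & B4 & B5). cbn [fst snd] in *.
    pose proof (Hw n). pose proof (Hh n). pose proof (Hw0 (S n)). pose proof (Hh0 (S n)).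
    assert (E : x + w n = x + w (S n) + w (S n)) by lra.
    assert (E' : y + h n = y + h (S n) + h (S n)) by lra.
    rewrite (box_flux_split x (x + w (S n)) (x + w n) y (y + h (S n)) (y + h n)) in B5.
    2: { intros u v Hu Hv. apply Hbal; lra. }
    2: lra. 2: lra.
    rewrite E, E' in B5.
    assert (E4 : J / 4 ^ n = 4 * (J / 4 ^ S n)).
    { simpl. field. apply pow_nonzero. lra. }
    rewrite E4 in B5.
    destruct (Rle_dec (J / 4 ^ S n) (Rabs (box_flux U V x (x + w (S n)) y (y + h (S n))))) as [C1|C1].
    { exists (x, y). unfold bad. cbn [fst snd]. repeat split; lra. }
    destruct (Rle_dec (J / 4 ^ S n) (Rabs (box_flux U V (x + w (S n)) (x + w (S n) + w (S n)) y (y + h (S n))))) as [C2|C2].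
    { exists (x + w (S n), y). unfold bad. cbn [fst snd]. repeat split; lra. }
    destruct (Rle_dec (J / 4 ^ S n) (Rabs (box_flux U V x (x + w (S n)) (y + h (S n)) (y + h (S n) + h (S n))))) as [C3|C3].
    { exists (x, y + h (S n)). unfold bad. cbn [fst snd]. repeat split; lra. }
    (* If the first three quarters fall short, the triangle inequality leaves the last one. *)
    exists (x + w (S n), y + h (S n)). unfold bad. cbn [fst snd]. repeat split; try lra.
    revert B5 C1 C2 C3. unfold Rabs. repeat destruct Rcase_abs; lra. }
  (* The generation is part of the argument because [bad] depends on it; a corner that is not bad is
     sent to itself. *)
  destruct (choice (fun (np : nat * (R * R)) q => bad (fst np) (snd np) ->
     bad (S (fst np)) q /\ fst (snd np) <= fst q /\ snd (snd np) <= snd q /\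
     fst q + w (S (fst np)) <= fst (snd np) + w (fst np) /\
     snd q + h (S (fst np)) <= snd (snd np) + h (fst np))) as [next Hnext].
  { intros [n p]. cbn [fst snd]. destruct (classic (bad n p)) as [Hb|Hb].
    - destruct (step n p Hb) as [q Hq]. exists q. auto.
    - exists p. tauto. }
  set (P := fix P (n : nat) : R * R :=
    match n with O => (a, c) | S m => next (m, P m) end).
  assert (HP : forall n, bad n (P n)).
  { induction n as [|n IH].
    - unfold bad, w, h. cbn [P fst snd]. simpl pow.
      replace (a + (b - a) / 1) with b by field. replace (c + (d - c) / 1) with d by field.
      repeat split; try lra. unfold J. lra.
    - cbn [P]. exact (proj1 (Hnext (n, P n) IH)). }
  assert (HS : forall n, fst (P n) <= fst (P (S n)) /\ snd (P n) <= snd (P (S n)) /\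
     fst (P (S n)) + w (S n) <= fst (P n) + w n /\
     snd (P (S n)) + h (S n) <= snd (P n) + h n).
  { intros n. cbn [P]. exact (proj2 (Hnext (n, P n) (HP n))). }
  assert (Hmono : forall n k, fst (P n) <= fst (P (n + k)%nat) /\ snd (P n) <= snd (P (n + k)%nat) /\
     fst (P (n + k)%nat) + w (n + k)%nat <= fst (P n) + w n /\
     snd (P (n + k)%nat) + h (n + k)%nat <= snd (P n) + h n).
  { intros n. induction k as [|k IH].
    - rewrite Nat.add_0_r. lra.
    - rewrite Nat.add_succ_r. specialize (HS (n + k)%nat). lra. }
  destruct (Un_cv_crit (fun n => fst (P n))) as [x Hx].
  { intros n. apply HS. }
  { exists b. intros r [n ->]. destruct (HP n) as (? & ? & _). specialize (Hw0 n). lra. }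
  destruct (Un_cv_crit (fun n => snd (P n))) as [y Hy].
  { intros n. apply HS. }
  { exists d. intros r [n ->]. destruct (HP n) as (? & ? & ? & ? & _). specialize (Hh0 n). lra. }
  apply is_lim_seq_Reals in Hx. apply is_lim_seq_Reals in Hy.
  assert (Bx : forall n, fst (P n) <= x <= fst (P n) + w n).
  { intros n. apply (is_lim_seq_incr_n _ n) in Hx. split.
    - apply (is_lim_seq_le (fun _ => fst (P n)) _ (fst (P n)) x) in Hx.
      + exact Hx.
      + intros k. rewrite Nat.add_comm. apply Hmono.
      + apply is_lim_seq_const.
    - apply (is_lim_seq_le _ (fun _ => fst (P n) + w n) x (fst (P n) + w n)) in Hx.
      + exact Hx.
      + intros k. rewrite Nat.add_comm. destruct (Hmono n k) as (_ & _ & ? & _).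
        specialize (Hw0 (n + k)%nat). lra.
      + apply is_lim_seq_const. }
  assert (By : forall n, snd (P n) <= y <= snd (P n) + h n).
  { intros n. apply (is_lim_seq_incr_n _ n) in Hy. split.
    - apply (is_lim_seq_le (fun _ => snd (P n)) _ (snd (P n)) y) in Hy.
      + exact Hy.
      + intros k. rewrite Nat.add_comm. apply Hmono.
      + apply is_lim_seq_const.
    - apply (is_lim_seq_le _ (fun _ => snd (P n) + h n) y (snd (P n) + h n)) in Hy.
      + exact Hy.
      + intros k. rewrite Nat.add_comm. destruct (Hmono n k) as (_ & _ & _ & ?).
        specialize (Hh0 (n + k)%nat). lra.
      + apply is_lim_seq_const. }
  set (L := (b - a) + (d - c)).
  assert (HL : 0 <= L) by (unfold L; lra).
  assert (HL1 : 0 < L ^ 2 + 1) by nra.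
  (* A box of generation $n$ has $w+h=L/2^n$, so this tolerance bounds its flux by
     $\frac{L^2}{2(L^2+1)}\,J/4^n<J/4^n$. The added 1 covers $L=0$. *)
  destruct (box_flux_small x y (J / (2 * (L ^ 2 + 1)))) as (delta & Hd & Hsmall).
  { apply Hbal.
    - specialize (Bx 0%nat). destruct (HP 0%nat) as (? & ? & ? & ? & _). lra.
    - specialize (By 0%nat). destruct (HP 0%nat) as (? & ? & ? & ? & _). lra. }
  { apply Rdiv_lt_0_compat; lra. }
  destruct (pow_lt_1_zero (/ 2)) with (y := delta / (L + 1)) as [N HN].
  { rewrite Rabs_pos_eq; lra. }
  { apply Rdiv_lt_0_compat; lra. }
  specialize (HN N (le_n N)).
  assert (H2N : 0 < 2 ^ N) by (apply pow_lt; lra).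
  rewrite pow_inv in HN by lra.
  rewrite Rabs_pos_eq in HN by (left; apply Rinv_0_lt_compat; exact H2N).
  assert (HLN : L / 2 ^ N < delta).
  { apply (Rmult_lt_compat_l (L + 1)) in HN; [|lra].
    replace ((L + 1) * (delta / (L + 1))) with delta in HN by (field; lra).
    assert (0 < / 2 ^ N) by (apply Rinv_0_lt_compat; exact H2N).
    unfold Rdiv. lra. }
  assert (HwhN : w N + h N = L / 2 ^ N).
  { unfold w, h, L. field. lra. }
  destruct (HP N) as (B1 & B2 & B3 & B4 & B5).
  specialize (Hw0 N). specialize (Hh0 N).
  specialize (Hsmall (fst (P N)) (fst (P N) + w N) (snd (P N)) (snd (P N) + h N)).
  assert (Hs : Rabs (box_flux U V (fst (P N)) (fst (P N) + w N) (snd (P N)) (snd (P N) + h N))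
     <= J / (2 * (L ^ 2 + 1)) * (L / 2 ^ N) ^ 2).
  { rewrite <- HwhN. replace (w N + h N) with
      (fst (P N) + w N - fst (P N) + (snd (P N) + h N - snd (P N))) by ring.
    apply Hsmall; try apply Bx; try apply By; try lra.
    intros u v Hu Hv. apply Hbal; lra. }
  assert (E4 : 4 ^ N = 2 ^ N * 2 ^ N).
  { rewrite <- Rpow_mult_distr. now replace (2 * 2) with 4 by ring. }
  assert (Hc : J / 4 ^ N <= J / (2 * (L ^ 2 + 1)) * (L / 2 ^ N) ^ 2) by lra.
  rewrite E4 in Hc.
  apply (Rmult_le_compat_r (2 ^ N * 2 ^ N)) in Hc; [|nra].
  replace (J / (2 ^ N * 2 ^ N) * (2 ^ N * 2 ^ N)) with J in Hc by (field; lra).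
  replace (J / (2 * (L ^ 2 + 1)) * (L / 2 ^ N) ^ 2 * (2 ^ N * 2 ^ N))
    with (J * (L ^ 2 / (2 * (L ^ 2 + 1)))) in Hc by (field; lra).
  assert (L ^ 2 / (2 * (L ^ 2 + 1)) < 1).
  { apply (Rmult_lt_reg_r (2 * (L ^ 2 + 1))); [lra|].
    unfold Rdiv. rewrite Rmult_assoc, Rinv_l by lra. lra. }
  nra.
Qed.

End Flux.

(** * Complex derivatives *)

Notation is_C_derive := (is_derive (K := C_AbsRing) (V := C_NormedModule)).

Lemma is_C_derive_iff (f : C -> C) (z l : C) :
  is_C_derive f z l <->
  (forall eps : R, 0 < eps -> exists delta : R, 0 < delta /\ forall w : C,
     Cmod (w - z)%C < delta ->
     Cmod (f w - f z - (w - z) * l)%C <= eps * Cmod (w - z)%C).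
Proof.
  split.
  - intros [_ H] eps He.
    destruct (H z (fun P HP => HP) (mkposreal eps He)) as [d Hd].
    exists d. split; [apply cond_pos|]. intros w Hw. exact (Hd w Hw).
  - intros H. split.
    + apply is_linear_scal_l.
    + intros x Hx.
      apply (is_filter_lim_locally_unique (K := C_AbsRing)
        (V := AbsRing_NormedModule C_AbsRing)) in Hx.
      subst x. intros eps. destruct (H eps (cond_pos eps)) as (d & Hd & Hw).
      exists (mkposreal d Hd). intros w Hwd. exact (Hw w Hwd).
Qed.

(** The two module structures on [C] give the same estimate; the chain and product rules are stated
    for the one that comes from the ring. *)
Lemma is_C_derive_AbsRing (f : C -> C) (z l : C) :
  is_C_derive f z l <->
  is_derive (K := C_AbsRing) (V := AbsRing_NormedModule C_AbsRing) f z l.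
Proof.
  split; intros [H1 H2].
  - split; [apply is_linear_scal_l|]. exact H2.
  - split; [apply is_linear_scal_l|]. exact H2.
Qed.

Lemma is_C_derive_eq (f : C -> C) (z l l' : C) :
  is_C_derive f z l -> l = l' -> is_C_derive f z l'.
Proof. now intros H <-. Qed.

Lemma is_C_derive_comp (f g : C -> C) (z df dg : C) :
  is_C_derive f (g z) df -> is_C_derive g z dg ->
  is_C_derive (fun w => f (g w)) z (dg * df)%C.
Proof.
  intros Hf Hg. apply is_C_derive_AbsRing in Hg.
  exact (is_derive_comp f g z df dg Hf Hg).
Qed.

Lemma is_C_derive_mult (f g : C -> C) (z df dg : C) :
  is_C_derive f z df -> is_C_derive g z dg ->
  is_C_derive (fun w => f w * g w)%C z (df * g z + f z * dg)%C.
Proof.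
  intros Hf Hg. apply is_C_derive_AbsRing in Hf. apply is_C_derive_AbsRing in Hg.
  apply is_C_derive_AbsRing.
  exact (is_derive_mult (K := C_AbsRing) f g z df dg Hf Hg Cmult_comm).
Qed.

Lemma is_C_derive_plus (f g : C -> C) (z df dg : C) :
  is_C_derive f z df -> is_C_derive g z dg ->
  is_C_derive (fun w => f w + g w)%C z (df + dg)%C.
Proof. exact (is_derive_plus (V := C_NormedModule) f g z df dg). Qed.

Lemma is_C_derive_minus (f g : C -> C) (z df dg : C) :
  is_C_derive f z df -> is_C_derive g z dg ->
  is_C_derive (fun w => f w - g w)%C z (df - dg)%C.
Proof. exact (is_derive_minus (V := C_NormedModule) f g z df dg). Qed.

Lemma is_C_derive_const (a z : C) : is_C_derive (fun _ => a) z (RtoC 0).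
Proof. exact (is_derive_const (V := C_NormedModule) a z). Qed.

Lemma is_C_derive_id (z : C) : is_C_derive (fun w => w) z (RtoC 1).
Proof. apply is_C_derive_AbsRing. exact (is_derive_id (K := C_AbsRing) z). Qed.

Lemma is_C_derive_inv (z : C) :
  z <> 0%C -> is_C_derive (fun w => / w)%C z (- / (z * z))%C.
Proof.
  intros Hz. assert (Hm : 0 < Cmod z) by (apply Cmod_gt_0; exact Hz).
  apply is_C_derive_iff. intros eps He.
  (* The first bound keeps $|w|>|z|/2$; the second controls the remainder $(w-z)^2/(wz^2)$. *)
  exists (Rmin (Cmod z / 2) (eps * (Cmod z) ^ 3 / 2)). split.
  { assert (0 < Cmod z ^ 3) by (apply pow_lt; exact Hm).
    apply Rmin_pos; [lra|nra]. }
  intros w Hw.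
  assert (Hw1 : Cmod (w - z)%C < Cmod z / 2) by (eapply Rlt_le_trans; [exact Hw|apply Rmin_l]).
  assert (Hw2 : Cmod (w - z)%C < eps * (Cmod z) ^ 3 / 2)
    by (eapply Rlt_le_trans; [exact Hw|apply Rmin_r]).
  assert (Hwz : Cmod z / 2 < Cmod w).
  { pose proof (Cmod_triangle w (- (w - z))%C) as T.
    replace (w + - (w - z))%C with z in T by ring. rewrite Cmod_opp in T. lra. }
  assert (Hw0 : w <> 0%C) by (apply Cmod_gt_0; lra).
  replace (/ w - / z - (w - z) * - / (z * z))%C
    with ((w - z) * (w - z) * / (w * (z * z)))%C by (field; auto).
  rewrite !Cmod_mult, Cmod_inv, !Cmod_mult.
  2: { apply Cmod_gt_0. rewrite !Cmod_mult. apply Rmult_lt_0_compat; nra. }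
  set (d := Cmod (w - z)%C) in *. set (m := Cmod z) in *. set (n := Cmod w) in *.
  assert (0 <= d) by apply Cmod_ge_0.
  assert (Hnm : 0 < n * (m * m)) by (apply Rmult_lt_0_compat; nra).
  apply (Rmult_le_reg_r (n * (m * m))); [exact Hnm|].
  rewrite Rmult_assoc, Rinv_l by lra.
  rewrite Rmult_1_r. rewrite (Rmult_comm eps d), Rmult_assoc.
  apply Rmult_le_compat_l; [assumption|].
  apply Rle_trans with (eps * m ^ 3 / 2); [lra|].
  replace (eps * m ^ 3 / 2) with (eps * (m * m) * (m / 2)) by field.
  replace (eps * (n * (m * m))) with (eps * (m * m) * n) by ring.
  apply Rmult_le_compat_l; [|lra]. nra.
Qed.

Lemma Cmod_le_abs (x y : R) : Cmod (x, y) <= Rabs x + Rabs y.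
Proof.
  replace (x, y) with (RtoC x + Ci * RtoC y)%C
    by (unfold RtoC, Ci, Cplus, Cmult; simpl; f_equal; ring).
  eapply Rle_trans; [apply Cmod_triangle|].
  rewrite Cmod_mult, Cmod_Ci, !Cmod_R. lra.
Qed.

Lemma abs_Im_le_Cmod (z : C) : Rabs (Im z) <= Cmod z.
Proof. eapply Rle_trans; [|apply Rmax_Cmod]. apply Rmax_r. Qed.

(** Multiplication by $p+iq$ is the real matrix with rows $(p,-q)$ and $(q,p)$: the Cauchy-Riemann
    equations. *)
Lemma is_C_derive_differentiable (f : C -> C) (x y : R) (l : C) :
  is_C_derive f (x, y) l ->
  differentiable_pt_lim (fun u v => Re (f (u, v))) x y (Re l) (- Im l) /\
  differentiable_pt_lim (fun u v => Im (f (u, v))) x y (Im l) (Re l).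
Proof.
  intros H. rewrite is_C_derive_iff in H.
  assert (H' : forall eps : posreal, exists delta : posreal, forall u v,
    Rabs (u - x) < delta -> Rabs (v - y) < delta ->
    Cmod (f (u, v) - f (x, y) - ((u, v) - (x, y)) * l)%C
      <= eps * Rmax (Rabs (u - x)) (Rabs (v - y))).
  (* Half of [eps], since $|u-x|+|v-y|$ is at most twice the maximum. *)
  { intros eps. destruct (H (eps / 2)) as (d & Hd & Hf).
    { pose proof (cond_pos eps). lra. }
    exists (mkposreal (d / 2) ltac:(lra)). intros u v Hu Hv. simpl in Hu, Hv.
    assert (Hm : Cmod ((u, v) - (x, y))%C <= Rabs (u - x) + Rabs (v - y)).
    { apply (Cmod_le_abs (u - x) (v - y)). }
    eapply Rle_trans; [apply Hf; lra|].
    pose proof (Rmax_l (Rabs (u - x)) (Rabs (v - y))).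
    pose proof (Rmax_r (Rabs (u - x)) (Rabs (v - y))).
    pose proof (cond_pos eps). nra. }
  split; intros eps; destruct (H' eps) as [d Hd]; exists d; intros u v Hu Hv;
    (eapply Rle_trans; [|apply (Hd u v Hu Hv)]).
  - eapply Rle_trans; [|apply re_le_Cmod]. right. f_equal.
    destruct l. unfold Re, Im, Cminus, Cplus, Copp, Cmult. simpl. ring.
  - eapply Rle_trans; [|apply abs_Im_le_Cmod]. right. f_equal.
    destruct l. unfold Re, Im, Cminus, Cplus, Copp, Cmult. simpl. ring.
Qed.

(** The converse, through which [Cexp] is differentiated by its real and imaginary parts. *)
Lemma differentiable_is_C_derive (f : C -> C) (x y p q : R) :
  differentiable_pt_lim (fun u v => Re (f (u, v))) x y p (- q) ->
  differentiable_pt_lim (fun u v => Im (f (u, v))) x y q p ->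
  is_C_derive f (x, y) (p, q).
Proof.
  intros HU HV. apply is_C_derive_iff. intros eps He.
  destruct (HU (mkposreal (eps / 2) ltac:(lra))) as [d1 H1].
  destruct (HV (mkposreal (eps / 2) ltac:(lra))) as [d2 H2].
  exists (Rmin d1 d2). split; [apply Rmin_pos; apply cond_pos|].
  intros [u v] Hw. pose proof (Rmin_l d1 d2). pose proof (Rmin_r d1 d2).
  pose proof (re_le_Cmod ((u, v) - (x, y))%C) as Tu.
  pose proof (abs_Im_le_Cmod ((u, v) - (x, y))%C) as Tv.
  change (Re ((u, v) - (x, y))%C) with (u - x) in Tu.
  change (Im ((u, v) - (x, y))%C) with (v - y) in Tv.
  specialize (H1 u v ltac:(lra) ltac:(lra)). specialize (H2 u v ltac:(lra) ltac:(lra)).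
  simpl in H1, H2.
  set (A := Re (f (u, v)) - Re (f (x, y)) - (p * (u - x) + - q * (v - y))) in *.
  set (B := Im (f (u, v)) - Im (f (x, y)) - (q * (u - x) + p * (v - y))) in *.
  replace (f (u, v) - f (x, y) - ((u, v) - (x, y)) * (p, q))%C with (A, B).
  2: { unfold A, B. destruct (f (u, v)), (f (x, y)).
       unfold Re, Im, Cminus, Cplus, Copp, Cmult. simpl. f_equal; ring. }
  eapply Rle_trans; [apply Cmod_le_abs|].
  set (M := Rmax (Rabs (u - x)) (Rabs (v - y))) in *.
  assert (HM : M <= Cmod ((u, v) - (x, y))%C) by (apply Rmax_lub; lra).
  nra.
Qed.

Lemma is_C_derive_Cexp (z : C) : is_C_derive Cexp z (Cexp z).
Proof.
  destruct z as [x y].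
  assert (Hm : forall u v : R, differentiable_pt_lim (fun u v => u * v) u v v u).
  { intros u v. apply filterdiff_differentiable_pt_lim.
    apply (filterdiff_ext_lin _ (fun t : R * R => plus (mult (fst t) v) (mult u (snd t)))).
    - apply (filterdiff_mult (K := R_AbsRing) (u, v)); [intros P HP; exact HP|exact Rmult_comm].
    - intros [a b]. unfold plus, mult. simpl. ring. }
  assert (Hx : forall (h : R -> R) l, derivable_pt_lim h x l ->
     differentiable_pt_lim (fun u _ => h u) x y l 0).
  { intros h l Hh. apply differentiable_pt_lim_proj1_0. exact Hh. }
  assert (Hy : forall (h : R -> R) l, derivable_pt_lim h y l ->
     differentiable_pt_lim (fun _ v => h v) x y 0 l).
  { intros h l Hh eps. destruct (differentiable_pt_lim_proj1_0 h y x l Hh eps) as [d Hd].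
    exists d. intros u v Hu Hv. rewrite Rmax_comm.
    replace (0 * (u - x) + l * (v - y)) with (l * (v - y) + 0 * (u - x)) by ring.
    apply Hd; assumption. }
  unfold Cexp at 2. cbn [Re Im fst snd].
  apply differentiable_is_C_derive; unfold Cexp; cbn [Re Im fst snd].
  - replace (exp x * cos y) with (cos y * exp x + exp x * 0) by ring.
    replace (- (exp x * sin y)) with (cos y * 0 + exp x * - sin y) by ring.
    apply (differentiable_pt_lim_comp (fun a b => a * b) (fun u _ => exp u) (fun _ v => cos v)).
    + apply Hm.
    + apply Hx, derivable_pt_lim_exp.
    + apply Hy, derivable_pt_lim_cos.
  - replace (exp x * sin y) with (sin y * exp x + exp x * 0) by ring.
    replace (exp x * cos y) with (sin y * 0 + exp x * cos y) by ring.
    apply (differentiable_pt_lim_comp (fun a b => a * b) (fun u _ => exp u) (fun _ v => sin v)).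
    + apply Hm.
    + apply Hx, derivable_pt_lim_exp.
    + apply Hy, derivable_pt_lim_sin.
Qed.

Lemma RtoC_inj_neq (x y : R) : x <> y -> RtoC x <> RtoC y.
Proof. intros H E. apply H, RtoC_inj, E. Qed.

(** * Harnack's inequality on the half-plane *)

Lemma Cmod_Cexp (z : C) : Cmod (Cexp z) = exp (Re z).
Proof.
  unfold Cexp, Cmod. cbn [fst snd].
  replace ((exp (Re z) * cos (Im z)) ^ 2 + (exp (Re z) * sin (Im z)) ^ 2)
    with (exp (Re z) ^ 2 * (Rsqr (sin (Im z)) + Rsqr (cos (Im z)))) by (unfold Rsqr; ring).
  rewrite sin2_cos2, Rmult_1_r. apply sqrt_pow2. left. apply exp_pos.
Qed.

Lemma is_C_derive_balanced (F : C -> C) (x y : R) (l : C) :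
  is_C_derive F (x, y) l ->
  balanced_at (fun u v => Re (F (u, v))) (fun u v => Im (F (u, v))) x y.
Proof.
  intros H. apply is_C_derive_differentiable in H.
  exists (Re l), (- Im l), (Im l). exact H.
Qed.

(** With $w=e^z$ the circle becomes a vertical segment of length $2\pi$ and the puncture moves to
    $\operatorname{Re}z=-\infty$. By [box_flux_zero] the integral is the same for all radii, and its
    value is found as the radius tends to 0. *)
Lemma RInt_circle_punctured (H : C -> C) (L : C) (r : R) :
  (forall w : C, 0 < Cmod w < 1 -> exists l, is_C_derive H w l) ->
  (forall eps : R, 0 < eps -> exists delta : R, 0 < delta /\
     forall w : C, 0 < Cmod w < delta -> Cmod (H w - L)%C < eps) ->
  0 < r < 1 ->
  is_RInt (fun t => Re (H (r * cos t, r * sin t))) 0 (2 * PI) (2 * PI * Re L).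
Proof.
  intros HH Hlim Hr. pose proof PI_RGT_0 as Hpi.
  set (F := fun z : C => H (Cexp z)).
  set (U := fun u v : R => Re (F (u, v))). set (V := fun u v : R => Im (F (u, v))).
  assert (Hbal : forall x y, x < 0 -> balanced_at U V x y).
  { intros x y Hx.
    assert (Hw : 0 < Cmod (Cexp (x, y)) < 1).
    { rewrite Cmod_Cexp. cbn [Re fst]. split; [apply exp_pos|].
      rewrite <- exp_0. apply exp_increasing. exact Hx. }
    destruct (HH _ Hw) as [l Hl].
    apply is_C_derive_balanced with (l := (Cexp (x, y) * l)%C).
    apply (is_C_derive_comp H Cexp); [exact Hl|apply is_C_derive_Cexp]. }
  assert (HlnU : ln r < 0) by (rewrite <- ln_1; apply ln_increasing; lra).
  assert (Hex : forall x, x < 0 -> ex_RInt (fun y => U x y) 0 (2 * PI)).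
  { intros x Hx. apply (balanced_ex_RInt_U U V x x 0 (2 * PI)); try lra.
    intros u v Hu _. apply Hbal. lra. }
  (* [Cexp] has period $2\pi i$, so the two horizontal edges cancel. *)
  assert (HV : forall x, V x (2 * PI) - V x 0 = 0).
  { intros x. unfold V, F, Cexp. cbn [Re Im fst snd].
    rewrite cos_2PI, sin_2PI, cos_0, sin_0. ring. }
  assert (Hconst : forall x, x <= ln r ->
    RInt (fun y => U (ln r) y) 0 (2 * PI) = RInt (fun y => U x y) 0 (2 * PI)).
  { intros x Hx.
    assert (E : box_flux U V x (ln r) 0 (2 * PI) = 0).
    { apply box_flux_zero; try lra. intros u v Hu _. apply Hbal. lra. }
    unfold box_flux in E.
    rewrite (RInt_ext (V := R_CompleteNormedModule) (fun x => V x (2 * PI) - V x 0) (fun _ => 0)) in E.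
    2: { intros. apply HV. }
    rewrite RInt_const in E.
    rewrite (RInt_minus (V := R_CompleteNormedModule) (fun y => U (ln r) y) (fun y => U x y)) in E.
    2, 3: apply Hex; lra.
    unfold scal, minus, plus, opp in E. simpl in E. unfold mult in E. simpl in E. lra. }
  assert (Hval : RInt (fun y => U (ln r) y) 0 (2 * PI) = 2 * PI * Re L).
  { apply Req_lt_aux. intros eps.
    destruct (Hlim (eps / (4 * PI))) as (d & Hd & Hw).
    { apply Rdiv_lt_0_compat; [apply cond_pos|lra]. }
    (* Left of [ln r], and so far left that on the circle of radius $e^x$ the values of [H] are
       close to [L]. *)
    set (x := Rmin (ln r) (ln (d / 2))).
    assert (Hx1 : x <= ln r) by apply Rmin_l.
    assert (Hx2 : exp x < d).
    { apply Rle_lt_trans with (d / 2); [|lra]. rewrite <- (exp_ln (d / 2)) by lra.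
      assert (Hx2 : x <= ln (d / 2)) by apply Rmin_r.
      destruct Hx2 as [Hx2| ->]; [left; now apply exp_increasing|lra]. }
    rewrite (Hconst x Hx1).
    assert (E : RInt (fun y => U x y - Re L) 0 (2 * PI)
        = RInt (fun y => U x y) 0 (2 * PI) - 2 * PI * Re L).
    { rewrite (RInt_minus (V := R_CompleteNormedModule) (fun y => U x y) (fun _ => Re L)).
      - rewrite RInt_const. unfold scal, minus, plus, opp. simpl. unfold mult. simpl. ring.
      - apply Hex. lra.
      - apply ex_RInt_const. }
    rewrite <- E.
    apply Rle_lt_trans with ((2 * PI - 0) * (eps / (4 * PI))).
    - apply abs_RInt_le_const; [lra| |].
      + apply (ex_RInt_minus (V := R_CompleteNormedModule)).
        * apply Hex. lra.
        * apply ex_RInt_const.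
      + intros t _. left. eapply Rle_lt_trans.
        2: { apply (Hw (Cexp (x, t))). rewrite Cmod_Cexp. cbn [Re fst].
             split; [apply exp_pos|exact Hx2]. }
        eapply Rle_trans; [|apply re_le_Cmod]. right. f_equal.
    - pose proof (cond_pos eps). replace ((2 * PI - 0) * (eps / (4 * PI))) with (eps / 2) by (field; lra).
      lra. }
  rewrite <- Hval.
  apply (is_RInt_ext (V := R_CompleteNormedModule) (fun y => U (ln r) y)).
  { intros t _. unfold U, F, Cexp. cbn [Re Im fst snd]. now rewrite exp_ln by lra. }
  apply (RInt_correct (V := R_CompleteNormedModule)). apply Hex. exact HlnU.
Qed.

(* The multiplier [2 + r/w + w/r] equals [2 + 2 cos t >= 0] at [w = r e^(it)]. *)
Lemma Re_derive_disc (g : C -> C) (l : C) :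
  (forall w : C, Cmod w < 1 -> ex_derive (K := C_AbsRing) (V := C_NormedModule) g w) ->
  (forall w : C, Cmod w < 1 -> 0 <= Re (g w)) ->
  is_C_derive g (RtoC 0) l ->
  - 2 * Re (g 0%C) <= Re l.
Proof.
  intros Hg Hpos Hl. pose proof PI_RGT_0 as Hpi.
  assert (Hr : forall r, 0 < r < 1 -> - 2 * Re (g 0%C) <= r * Re l).
  { intros r Hr.
    (* As $w\to0$, $(g(w)-g(0))\,r/w\to r\,g'(0)$ and the other terms vanish, so [H] has the limit
       [r * l]. *)
    set (H := fun w : C => ((g w - g 0) * (2 + (r * / w + / r * w)))%C).
    assert (HrC : RtoC r <> 0%C) by (apply RtoC_inj_neq; lra).
    assert (I : is_RInt (fun t => Re (H (r * cos t, r * sin t))) 0 (2 * PI)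
        (2 * PI * Re (r * l)%C)).
    { apply RInt_circle_punctured; [| |exact Hr].
      - intros w Hw. destruct (Hg w (proj2 Hw)) as [d Hd].
        assert (Hw0 : w <> 0%C) by (apply Cmod_gt_0; apply Hw).
        eexists. apply is_C_derive_mult.
        + apply is_C_derive_minus; [exact Hd|apply is_C_derive_const].
        + apply is_C_derive_plus; [apply is_C_derive_const|].
          apply is_C_derive_plus.
          * apply is_C_derive_mult; [apply is_C_derive_const|apply is_C_derive_inv; exact Hw0].
          * apply is_C_derive_mult; [apply is_C_derive_const|apply is_C_derive_id].
      - intros eps He.
        rewrite is_C_derive_iff in Hl.
        (* Bounds both $|2w+r+w^2/r|$ and $|2+w/r|$ on the unit disc. *)
        set (K := 2 + r + / r).
        assert (Hir : 1 < / r) by (rewrite <- Rinv_1; apply Rinv_lt_contravar; lra).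
        pose proof (Cmod_ge_0 l) as Hml.
        destruct (Hl (eps / (2 * K))) as (d & Hd & Hd').
        { apply Rdiv_lt_0_compat; unfold K; lra. }
        exists (Rmin (Rmin d 1) (eps / (2 * K * (Cmod l + 1)))). split.
        { repeat apply Rmin_pos; try lra. apply Rdiv_lt_0_compat; unfold K; nra. }
        intros w [Hw0 Hw].
        assert (Hw1 : Cmod w < d).
        { eapply Rlt_le_trans; [exact Hw|]. eapply Rle_trans; [apply Rmin_l|apply Rmin_l]. }
        assert (Hw2 : Cmod w < 1).
        { eapply Rlt_le_trans; [exact Hw|]. eapply Rle_trans; [apply Rmin_l|apply Rmin_r]. }
        assert (Hw3 : Cmod w < eps / (2 * K * (Cmod l + 1))).
        { eapply Rlt_le_trans; [exact Hw|apply Rmin_r]. }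
        assert (Hwn : w <> 0%C) by (apply Cmod_gt_0; exact Hw0).
        specialize (Hd' w). replace (w - 0)%C with w in Hd' by ring.
        specialize (Hd' Hw1).
        unfold H.
        replace ((g w - g 0) * (2 + (r * / w + / r * w)) - r * l)%C
          with ((g w - g 0 - w * l) * (/ w * (2 * w + (r + / r * (w * w)))) +
            w * (l * (2 + / r * w)))%C by (field; auto).
        assert (M2 : Cmod 2 = 2) by (rewrite Cmod_R; apply Rabs_pos_eq; lra).
        assert (Mr : Cmod r = r) by (rewrite Cmod_R; apply Rabs_pos_eq; lra).
        assert (Mi : Cmod (/ r)%C = / r) by (rewrite Cmod_inv, Mr by exact HrC; reflexivity).
        assert (E1 : Cmod (2 * w + (r + / r * (w * w)))%C <= K).
        { eapply Rle_trans; [apply Cmod_triangle|].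
          pose proof (Cmod_triangle r (/ r * (w * w))%C) as T.
          rewrite Cmod_mult, M2. rewrite Mr, !Cmod_mult, Mi in T.
          pose proof (Rmult_le_compat_l (/ r) (Cmod w * Cmod w) 1 ltac:(lra) ltac:(nra)).
          unfold K. lra. }
        assert (E2 : Cmod (2 + / r * w)%C <= K).
        { eapply Rle_trans; [apply Cmod_triangle|].
          rewrite Cmod_mult, M2, Mi.
          pose proof (Rmult_le_compat_l (/ r) (Cmod w) 1 ltac:(lra) ltac:(lra)).
          unfold K. lra. }
        eapply Rle_lt_trans; [apply Cmod_triangle|].
        rewrite (Cmod_mult (g w - g 0 - w * l)), (Cmod_mult (/ w)), (Cmod_mult w), (Cmod_mult l).
        rewrite Cmod_inv by exact Hwn.
        set (m := Cmod w) in *.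
        assert (Hm : 0 < m) by exact Hw0.
        assert (B1 : Cmod (g w - g 0 - w * l)%C * (/ m * Cmod (2 * w + (r + / r * (w * w)))%C)
           <= eps / 2).
        { apply Rle_trans with ((eps / (2 * K) * m) * (/ m * K)).
          - apply Rmult_le_compat; try apply Cmod_ge_0.
            + apply Rmult_le_pos; [left; now apply Rinv_0_lt_compat|apply Cmod_ge_0].
            + exact Hd'.
            + apply Rmult_le_compat_l; [left; now apply Rinv_0_lt_compat|exact E1].
          - right. field. unfold K. lra. }
        assert (B2 : m * (Cmod l * Cmod (2 + / r * w)%C) < eps / 2).
        { apply Rle_lt_trans with (m * ((Cmod l + 1) * K)).
          - apply Rmult_le_compat_l; [lra|]. apply Rmult_le_compat; try lra; apply Cmod_ge_0.
          - assert (HK : 0 < (Cmod l + 1) * K) by (unfold K; nra).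
            apply (Rmult_lt_compat_r ((Cmod l + 1) * K)) in Hw3; [|exact HK].
            replace (eps / (2 * K * (Cmod l + 1)) * ((Cmod l + 1) * K)) with (eps / 2) in Hw3
              by (field; unfold K; lra).
            exact Hw3. }
        lra. }
    assert (I2 : is_RInt (fun t => - Re (g 0%C) * (2 + 2 * cos t)) 0 (2 * PI)
       (2 * PI * (- 2 * Re (g 0%C)))).
    { replace (2 * PI * (- 2 * Re (g 0%C))) with
        (minus (- Re (g 0%C) * (2 * (2 * PI) + 2 * sin (2 * PI)))
               (- Re (g 0%C) * (2 * 0 + 2 * sin 0))).
      2: { rewrite sin_2PI, sin_0. unfold minus, plus, opp. simpl. ring. }
      apply (is_RInt_derive (V := R_CompleteNormedModule)
        (fun t => - Re (g 0%C) * (2 * t + 2 * sin t))).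
      - intros t _. auto_derive; auto. ring.
      - intros t _. apply (ex_derive_continuous (K := R_AbsRing) (V := R_NormedModule)).
        auto_derive. auto. }
    (* On $|w|=r$ the multiplier is real and nonnegative, so $\operatorname{Re}g\ge0$ bounds the
       integrand of [I] below by that of [I2]. *)
    assert (Hle : 2 * PI * (- 2 * Re (g 0%C)) <= 2 * PI * Re (r * l)%C).
    { apply (is_RInt_le _ _ 0 (2 * PI) _ _ ltac:(lra) I2 I). intros t _.
      set (w := (r * cos t, r * sin t) : C).
      assert (Hsc : sin t * sin t + cos t * cos t = 1) by (apply sin2_cos2).
      assert (Hmw : Cmod w = r).
      { unfold w, Cmod. cbn [fst snd].
        replace ((r * cos t) ^ 2 + (r * sin t) ^ 2) with (r ^ 2).
        - apply sqrt_pow2. lra.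
        - transitivity (r ^ 2 * (sin t * sin t + cos t * cos t)); [rewrite Hsc; ring|ring]. }
      assert (Hwn : w <> 0%C) by (apply Cmod_gt_0; lra).
      assert (E : (2 + (r * / w + / r * w))%C = RtoC (2 + 2 * cos t)).
      { assert (Ew : (r * / w)%C = (cos t, (- sin t)%R)).
        { transitivity ((w * (cos t, (- sin t)%R)) * / w)%C; [|field; exact Hwn].
          f_equal. unfold w, RtoC, Cmult. simpl. f_equal; [|ring].
          transitivity (r * (sin t * sin t + cos t * cos t)); [rewrite Hsc; ring|ring]. }
        assert (Ew' : (/ r * w)%C = (cos t, sin t)).
        { transitivity (/ r * (r * (cos t, sin t)))%C; [|field; exact HrC].
          f_equal. unfold w, RtoC, Cmult. simpl. f_equal; ring. }
        rewrite Ew, Ew'. unfold RtoC, Cplus. simpl. f_equal; ring. }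
      unfold H. rewrite E.
      replace (Re ((g w - g 0) * RtoC (2 + 2 * cos t))%C)
        with ((Re (g w) - Re (g 0%C)) * (2 + 2 * cos t)).
      2: { unfold Re, RtoC, Cmult, Cminus, Cplus, Copp. simpl. ring. }
      pose proof (Hpos w ltac:(lra)). pose proof (COS_bound t).
      apply Rmult_le_compat_r; lra. }
    replace (Re (r * l)%C) with (r * Re l) in Hle
      by (unfold Re, RtoC, Cmult; simpl; ring).
    apply Rmult_le_reg_l in Hle; lra. }
  pose proof (Hpos 0%C ltac:(rewrite Cmod_0; lra)) as H0.
  destruct (Rle_dec 0 (Re l)) as [Hl0|Hl0]; [lra|].
  apply Rnot_lt_le. intros Hlt.
  (* This replaces $r\to1$: if the claim failed, $r=(q+1)/2$, strictly between $q$ and 1, would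
     violate [Hr]. *)
  set (q := - 2 * Re (g 0%C) / Re l).
  assert (Hq : q * Re l = - 2 * Re (g 0%C)) by (unfold q; field; lra).
  assert (Hq0 : 0 <= q).
  { apply Rnot_lt_le. intros Hn.
    pose proof (Rmult_lt_0_compat (- q) (- Re l) ltac:(lra) ltac:(lra)). lra. }
  assert (Hq1 : q < 1).
  { apply Rnot_le_lt. intros Hn.
    pose proof (Rmult_le_compat_r (- Re l) 1 q ltac:(lra) Hn). lra. }
  specialize (Hr ((q + 1) / 2) ltac:(lra)). lra.
Qed.

(* The Moebius map [w |-> x (1 + s w) / (1 - s w) + i y] carries the disc to the
   half-plane and 0 to [x + i y], with derivative [2 s x] at 0. *)
Lemma Re_derive_half_plane (f : C -> C) (z l : C) :
  holomorphic_on (half_plane 0) f ->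
  (forall s, half_plane 0 s -> 0 <= Re (f s)) ->
  half_plane 0 z -> is_C_derive f z l ->
  Rabs (Re l) * Re z <= Re (f z).
Proof.
  intros Hf Hpos Hz Hl.
  (* Here $s=\pm1$; the two signs give the two halves of the absolute value. *)
  assert (Hs : forall s : R, s * s = 1 -> - (s * Re l * Re z) <= Re (f z)).
  { intros s Hs2. unfold half_plane in Hz.
    set (psi := fun w : C => (Re z * ((1 + s * w) * / (1 - s * w)) + Ci * Im z)%C).
    assert (Hsm : forall w, Cmod (s * w)%C = Cmod w).
    { intros w. rewrite Cmod_mult, Cmod_R.
      replace (Rabs s) with 1; [ring|]. unfold Rabs. destruct Rcase_abs; nra. }
    assert (Hne : forall w, Cmod w < 1 -> (1 - s * w)%C <> 0%C).
    { intros w Hw E. assert (E' : (s * w)%C = 1%C).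
      { replace (s * w)%C with (1 - (1 - s * w))%C by ring. rewrite E. ring. }
      rewrite <- Hsm, E', Cmod_1 in Hw. lra. }
    assert (Hpsi0 : psi 0%C = z).
    { unfold psi. rewrite Cmult_0_r.
      replace (1 + 0)%C with (RtoC 1) by ring. replace (1 - 0)%C with (RtoC 1) by ring.
      replace (/ 1)%C with (RtoC 1) by (field; apply RtoC_inj_neq; lra).
      destruct z. unfold RtoC, Ci, Cplus, Cmult. simpl. f_equal; ring. }
    assert (Hmap : forall w, Cmod w < 1 -> half_plane 0 (psi w)).
    { intros w Hw. pose proof (Hne w Hw) as Hn. rewrite <- (Hsm w) in Hw.
      unfold psi, half_plane. set (v := (s * w)%C) in *.
      assert (Hv2 : Re v * Re v + Im v * Im v < 1).
      { pose proof (Cmod2_alt v) as E. pose proof (Cmod_ge_0 v). nra. }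
      destruct v as [a b]. unfold Re, Im in Hv2. cbn [fst snd] in Hv2.
      assert (Hd : 0 < (1 + - a) ^ 2 + (0 + - b) ^ 2) by nra.
      unfold Re at 1, RtoC, Ci, Cinv, Cminus, Copp, Cplus, Cmult. cbn [fst snd].
      (* The identity is $\operatorname{Re}\frac{1+v}{1-v}=\frac{1-|v|^2}{|1-v|^2}$. *)
      match goal with |- 0 < ?e =>
        replace e with (Re z * ((1 - (a * a + b * b)) / ((1 + - a) ^ 2 + (0 + - b) ^ 2)))
          by (field; lra) end.
      apply Rmult_lt_0_compat; [exact Hz|]. apply Rdiv_lt_0_compat; lra. }
    assert (Hder : forall w, Cmod w < 1 ->
      is_C_derive psi w (Re z * (2 * s * / ((1 - s * w) * (1 - s * w))))%C).
    { intros w Hw. pose proof (Hne w Hw) as Hn. eapply is_C_derive_eq.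
      - apply is_C_derive_plus; [|apply is_C_derive_const].
        apply is_C_derive_mult; [apply is_C_derive_const|].
        apply is_C_derive_mult.
        + apply is_C_derive_plus; [apply is_C_derive_const|].
          apply is_C_derive_mult; [apply is_C_derive_const|apply is_C_derive_id].
        + apply (is_C_derive_comp Cinv (fun w => 1 - s * w)%C).
          * apply is_C_derive_inv. exact Hn.
          * apply is_C_derive_minus; [apply is_C_derive_const|].
            apply is_C_derive_mult; [apply is_C_derive_const|apply is_C_derive_id].
      - cbv beta. field. exact Hn. }
    pose proof (Re_derive_disc (fun w => f (psi w)) ((Re z * (2 * s)) * l)%C) as D.
    cbv beta in D. rewrite Hpsi0 in D.
    assert (D' : - 2 * Re (f z) <= Re (Re z * (2 * s) * l)%C).
    { apply D.
      - intros w Hw. destruct (Hf (psi w) (Hmap w Hw)) as [d Hd].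
        eexists. apply (is_C_derive_comp f psi); [exact Hd|apply Hder; exact Hw].
      - intros w Hw. apply Hpos, Hmap, Hw.
      - eapply is_C_derive_eq.
        + apply (is_C_derive_comp f psi); [rewrite Hpsi0; exact Hl|].
          apply Hder. rewrite Cmod_0. lra.
        + rewrite Cmult_0_r. field. }
    replace (Re (Re z * (2 * s) * l)%C) with (2 * (s * Re l * Re z)) in D'
      by (unfold Re, RtoC, Cmult; simpl; ring).
    lra. }
  pose proof (Hs 1 ltac:(lra)). pose proof (Hs (-1) ltac:(lra)).
  unfold Rabs. destruct Rcase_abs; lra.
Qed.

(** Along a horizontal line, $|u'|x\le u$ fixes the signs of $(u/x)'=(u'x-u)/x^2$ and
    $(xu)'=u+xu'$. *)
Lemma Harnack (f : C -> C) (x1 x2 y : R) :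
  holomorphic_on (half_plane 0) f ->
  (forall s, half_plane 0 s -> 0 <= Re (f s)) ->
  0 < x1 -> x1 <= x2 ->
  x1 * Re (f (x2, y)) <= x2 * Re (f (x1, y)) /\
  x1 * Re (f (x1, y)) <= x2 * Re (f (x2, y)).
Proof.
  intros Hf Hpos H1 H12.
  set (u := fun x => Re (f (x, y))).
  assert (Hu : forall x, 0 < x -> exists d, is_derive u x d /\ Rabs d * x <= u x).
  { intros x Hx. destruct (Hf (x, y) Hx) as [l Hl]. exists (Re l). split.
    - apply is_derive_Reals.
      replace (Re l) with (Re l * 1 + - Im l * 0) by ring.
      apply (derivable_pt_lim_comp_2d (fun u v => Re (f (u, v))) (fun x => x) (fun _ => y)).
      + apply is_C_derive_differentiable. exact Hl.
      + apply derivable_pt_lim_id.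
      + apply derivable_pt_lim_const.
    - exact (Re_derive_half_plane f (x, y) l Hf Hpos Hx Hl). }
  assert (Hd : forall x, 0 < x -> is_derive u x (Derive u x) /\ Rabs (Derive u x) * x <= u x).
  { intros x Hx. destruct (Hu x Hx) as (d & D1 & D2).
    rewrite (is_derive_unique u x d D1). auto. }
  split.
  - assert (M : u x2 / x2 <= u x1 / x1).
    { destruct (MVT_gen (fun x => u x / x) x1 x2
        (fun x => (Derive u x * x - u x) / x ^ 2)) as (c & Hc & E).
      - intros x. rewrite Rmin_left by lra. intros Hx.
        destruct (Hd x ltac:(lra)) as [D _]. auto_derive.
        + split; [now exists (Derive u x)|]. split; [lra|auto].
        + change (Derive (fun x => u x) x) with (Derive u x). field. lra.
      - intros x. rewrite Rmin_left by lra. intros Hx. apply continuity_pt_filterlim.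
        destruct (Hd x ltac:(lra)) as [D _].
        apply (ex_derive_continuous (K := R_AbsRing) (V := R_NormedModule) (fun x => u x / x)). auto_derive.
        split; [now exists (Derive u x)|]. split; [lra|auto].
      - rewrite Rmin_left, Rmax_right in Hc by lra.
        destruct (Hd c ltac:(lra)) as [_ D].
        assert (Derive u c * c - u c <= 0).
        { pose proof (Rle_abs (Derive u c)). nra. }
        assert ((Derive u c * c - u c) / c ^ 2 <= 0).
        { apply Rle_div_l; [nra|]. lra. }
        nra. }
    apply (Rmult_le_compat_r (x1 * x2)) in M; [|nra].
    replace (u x2 / x2 * (x1 * x2)) with (x1 * u x2) in M by (field; lra).
    replace (u x1 / x1 * (x1 * x2)) with (x2 * u x1) in M by (field; lra).
    exact M.
  - destruct (MVT_gen (fun x => x * u x) x1 x2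
      (fun x => u x + x * Derive u x)) as (c & Hc & E).
    + intros x. rewrite Rmin_left by lra. intros Hx.
      destruct (Hd x ltac:(lra)) as [D _]. auto_derive.
      * now exists (Derive u x).
      * change (Derive (fun x => u x) x) with (Derive u x). ring.
    + intros x. rewrite Rmin_left by lra. intros Hx. apply continuity_pt_filterlim.
      destruct (Hd x ltac:(lra)) as [D _].
      apply (ex_derive_continuous (K := R_AbsRing) (V := R_NormedModule) (fun x => x * u x)). auto_derive.
      now exists (Derive u x).
    + rewrite Rmin_left, Rmax_right in Hc by lra.
      destruct (Hd c ltac:(lra)) as [_ D].
      assert (0 <= u c + c * Derive u c).
      { pose proof (Rle_abs (- Derive u c)). rewrite Rabs_Ropp in *. nra. }
      change (x1 * u x1 <= x2 * u x2). nra.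
Qed.

(** * Dirichlet series and asymptotic slopes *)

(** Stands in for letting $X\to\infty$ in the estimates below. *)
Lemma le_0_of_le_div (c K X0 : R) :
  0 <= K -> 0 < X0 -> (forall X, X0 <= X -> c <= K / X) -> c <= 0.
Proof.
  intros HK HX H. apply Rnot_lt_le. intros Hc.
  set (X := Rmax X0 ((K + 1) / c)).
  assert (H1 : X0 <= X) by apply Rmax_l.
  assert (H2 : (K + 1) / c <= X) by apply Rmax_r.
  specialize (H X H1).
  apply (Rmult_le_compat_r c) in H2; [|lra].
  replace ((K + 1) / c * c) with (K + 1) in H2 by (field; lra).
  apply (Rmult_le_compat_r X) in H; [|lra].
  replace (K / X * X) with K in H by (field; lra). lra.
Qed.

Lemma div_sqr_le (K x : R) : 0 <= K -> 1 <= x -> K / x ^ 2 <= K.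
Proof.
  intros HK Hx. assert (Hx2 : 1 <= x ^ 2) by nra.
  apply Rle_div_l; [lra|].
  pose proof (Rmult_le_compat_l K 1 (x ^ 2) HK Hx2). lra.
Qed.

(** Square $e^{x/2}\ge x/2$. *)
Lemma exp_neg_le_inv_sqr (x : R) : 0 < x -> exp (- x) <= 4 / x ^ 2.
Proof.
  intros Hx. rewrite exp_Ropp.
  assert (H : x / 2 <= exp (x / 2)) by (pose proof (exp_ineq1 (x / 2) ltac:(lra)); lra).
  assert (E : exp x = exp (x / 2) * exp (x / 2)) by (rewrite <- exp_plus; f_equal; field).
  replace (4 / x ^ 2) with (/ (x / 2 * (x / 2))) by (field; lra).
  apply Rinv_le_contravar; [nra|]. rewrite E. apply Rmult_le_compat; lra.
Qed.

Lemma Cmod_nat_cpow_opp (n : nat) (s : C) :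
  Cmod (nat_cpow_opp n s) = exp (- (Re s * ln (INR n))).
Proof.
  unfold nat_cpow_opp. rewrite Cmod_Cexp. f_equal.
  unfold Re, RtoC, Copp, Cmult. simpl. ring.
Qed.

Lemma nat_cpow_opp_1 (s : C) : nat_cpow_opp 1 s = RtoC 1.
Proof.
  unfold nat_cpow_opp. simpl INR. rewrite ln_1.
  replace (- (s * 0))%C with (RtoC 0) by ring.
  unfold Cexp, RtoC. simpl. rewrite exp_0, cos_0, sin_0. f_equal; ring.
Qed.

(** A term is the difference of two partial sums, and these are bounded. *)
Lemma C_series_terms_bounded (u : nat -> C) (l : C) :
  is_series (K := C_AbsRing) (V := C_NormedModule) u l ->
  exists M : R, forall n, Cmod (u n) <= M.
Proof.
  intros H.
  destruct (filterlim_bounded (K := C_AbsRing) (V := C_NormedModule) (sum_n u)) as [M HM].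
  { exists l. exact H. }
  assert (HM' : forall n, Cmod (sum_n (G := C_NormedModule) u n) <= M).
  { intros n. exact (HM n). }
  pose proof (HM' 0%nat) as HM0. rewrite sum_O in HM0.
  pose proof (Cmod_ge_0 (u 0%nat)).
  exists (M + M). intros [|n]; [lra|].
  pose proof (HM' n) as H1. pose proof (HM' (S n)) as H2. rewrite sum_Sn in H2.
  set (a := sum_n (G := C_NormedModule) u n) in *.
  change (plus a (u (S n))) with (a + u (S n))%C in H2.
  replace (u (S n)) with ((a + u (S n)) + - a)%C by ring.
  eapply Rle_trans; [apply Cmod_triangle|]. rewrite Cmod_opp. lra.
Qed.

(** Convergence at one point $s_0$ bounds $|a_n|n^{-s_0}$. Of the remaining
    $\operatorname{Re}s-s_0$, two units make the tail summable and the rest, $\tau$, yields the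
    factor $2^{-\tau}$, which is $O((\operatorname{Re}s)^{-2})$. *)
Lemma dirichlet_asymptotic (phi : C -> C) :
  in_dirichlet_class 0 phi ->
  exists (a1 : C) (K X0 : R), 0 <= K /\ 1 <= X0 /\
    forall s : C, X0 <= Re s -> Cmod (phi s - a1)%C <= K / Re s ^ 2.
Proof.
  intros (_ & a & theta & Hth & Hs).
  set (s0 := theta + 1).
  destruct (C_series_terms_bounded
    (fun n => (a (S n) * nat_cpow_opp (S n) (RtoC s0))%C) (phi (RtoC s0))) as [M HM].
  { apply Hs. unfold half_plane, s0. simpl. lra. }
  assert (HM' : forall n, Cmod (a (S n)) * exp (- (s0 * ln (INR (S n)))) <= M).
  { intros n. specialize (HM n). rewrite Cmod_mult, Cmod_nat_cpow_opp in HM.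
    exact HM. }
  assert (HM0 : 0 <= M).
  { eapply Rle_trans; [|apply (HM' 0%nat)]. apply Rmult_le_pos; [apply Cmod_ge_0|left; apply exp_pos]. }
  (* The threshold gives $\tau\ge X/2$, and 64 comes from $4/(X/4)^2$. *)
  exists (a 1%nat), (64 * M), (2 * (s0 + 2)). split; [lra|]. split; [unfold s0; lra|].
  intros s HX. set (X := Re s) in *.
  set (tau := X - s0 - 2).
  assert (Htau : X / 2 <= tau) by (unfold tau; lra).
  set (B := M * exp (- (tau * ln 2))).
  assert (HB0 : 0 <= B) by (apply Rmult_le_pos; [exact HM0|left; apply exp_pos]).
  (* The tail: [v k] is the term of index $n=k+2$. *)
  set (v := fun k => (a (S (S k)) * nat_cpow_opp (S (S k)) s)%C).
  assert (Hln2 : / 2 < ln 2) by apply ln_lt_2.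
  (* From $n^{-2}\le\frac1{n-1}-\frac1n$, a bound that telescopes in the sum. *)
  assert (Hv : forall k, Cmod (v k) <= B * (/ INR (S k) - / INR (S (S k)))).
  { intros k. unfold v. rewrite Cmod_mult, Cmod_nat_cpow_opp.
    set (L := ln (INR (S (S k)))).
    assert (HN : 1 <= INR (S k)) by (rewrite S_INR; pose proof (pos_INR k); lra).
    assert (HS : INR (S (S k)) = INR (S k) + 1) by apply S_INR.
    assert (HL : ln 2 <= L).
    { unfold L. destruct (Rle_lt_or_eq_dec 2 (INR (S (S k))) ltac:(lra)) as [h|h].
      - left. apply ln_increasing; lra.
      - rewrite <- h. lra. }
    replace (- (Re s * L)) with (- (s0 * L) + (- (tau * L) + - (L + L)))
      by (unfold tau, X; ring).
    rewrite !exp_plus, <- Rmult_assoc.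
    assert (E1 : exp (- (tau * L)) <= exp (- (tau * ln 2))).
    { assert (Hm : - (tau * L) <= - (tau * ln 2)).
      { apply Ropp_le_contravar. apply Rmult_le_compat_l; [unfold s0 in *; lra|exact HL]. }
      destruct Hm as [Hm| ->]; [left; now apply exp_increasing|lra]. }
    assert (E2 : exp (- (L + L)) <= / INR (S k) - / INR (S (S k))).
    { rewrite exp_Ropp, exp_plus. unfold L. rewrite exp_ln by lra. rewrite HS.
      replace (/ INR (S k) - / (INR (S k) + 1)) with (/ (INR (S k) * (INR (S k) + 1)))
        by (field; lra).
      apply Rinv_le_contravar; nra. }
    unfold B. rewrite (Rmult_assoc M).
    apply Rmult_le_compat.
    - apply Rmult_le_pos; [apply Cmod_ge_0|left; apply exp_pos].
    - apply Rmult_le_pos; left; apply exp_pos.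
    - exact (HM' (S k)).
    - apply Rmult_le_compat; try (left; apply exp_pos); assumption. }
  assert (Hsum : forall N, Cmod (sum_n (G := C_AbelianMonoid) v N) <= B * (1 - / INR (S (S N)))).
  { induction N as [|N IH].
    - rewrite sum_O. eapply Rle_trans; [apply Hv|]. right. simpl. field.
    - rewrite sum_Sn. eapply Rle_trans; [apply Cmod_triangle|].
      specialize (Hv (S N)). lra. }
  assert (Hlim : is_series (K := C_AbsRing) (V := C_NormedModule) v (phi s - a 1%nat)%C).
  { pose proof (Hs s) as Hser. unfold is_dirichlet_sum in Hser.
    assert (Hhp : half_plane theta s) by (unfold half_plane; fold X; unfold s0 in *; lra).
    specialize (Hser Hhp).
    apply (is_series_incr_1 (K := C_AbsRing) (V := C_NormedModule)
      (fun n => (a (S n) * nat_cpow_opp (S n) s)%C)).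
    replace (phi s) with (plus (phi s - a 1%nat) (a 1%nat * nat_cpow_opp 1 s))%C in Hser;
      [exact Hser|].
    rewrite nat_cpow_opp_1, Cmult_1_r. change (phi s - a 1%nat + a 1%nat = phi s)%C. ring. }
  assert (Hn : is_lim_seq (fun N => Cmod (sum_n (G := C_AbelianMonoid) v N))
     (Cmod (phi s - a 1%nat)%C)).
  { exact (filterlim_comp _ _ _ _ _ _ _ _ Hlim
      (filterlim_norm (K := C_AbsRing) (V := C_NormedModule) (phi s - a 1%nat)%C)). }
  assert (HB : Cmod (phi s - a 1%nat)%C <= B).
  { apply (is_lim_seq_le _ (fun _ => B) _ B) in Hn; [exact Hn| |apply is_lim_seq_const].
    intros N. eapply Rle_trans; [apply Hsum|].
    assert (0 < / INR (S (S N))) by (apply Rinv_0_lt_compat, lt_0_INR; lia). nra. }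
  eapply Rle_trans; [exact HB|]. unfold B.
  assert (HX0 : 0 < X) by (unfold s0 in *; lra).
  (* Here $\tau\ge X/2$ and $\ln2>1/2$. *)
  assert (E : exp (- (tau * ln 2)) <= exp (- (X / 4))).
  { assert (Hm : - (tau * ln 2) <= - (X / 4)).
    { apply Ropp_le_contravar.
      pose proof (Rmult_le_compat (X / 2) tau (/ 2) (ln 2) ltac:(lra) ltac:(lra) ltac:(lra) ltac:(lra)).
      lra. }
    destruct Hm as [Hm| ->]; [left; now apply exp_increasing|lra]. }
  pose proof (exp_neg_le_inv_sqr (X / 4) ltac:(lra)) as E'.
  replace (64 * M / X ^ 2) with (M * (4 / (X / 4) ^ 2)) by (field; lra).
  apply Rmult_le_compat_l; lra.
Qed.

(** Keeps only $f(s)=cs+O(1)$ far to the right, a relation that passes to compositions without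
    composing Dirichlet series. *)
Definition asymptotic_slope (f : C -> C) (c : nat) : Prop :=
  exists theta M : R, 1 <= theta /\ 0 <= M /\
    forall s : C, theta <= Re s -> Cmod (f s - INR c * s)%C <= M.

(** On the real axis the two approximations give $|c-d|X\le M_1+M_2$ for all large $X$. *)
Lemma asymptotic_slope_unique (f : C -> C) (c d : nat) :
  asymptotic_slope f c -> asymptotic_slope f d -> c = d.
Proof.
  intros (t1 & M1 & Ht1 & HM1 & H1) (t2 & M2 & Ht2 & HM2 & H2).
  apply INR_eq. apply Rminus_diag_uniq.
  assert (E : Rabs (INR c - INR d) <= 0).
  { apply (le_0_of_le_div _ (M1 + M2) (Rmax t1 t2)).
    - lra.
    - pose proof (Rmax_l t1 t2). lra.
    - intros X HX. pose proof (Rmax_l t1 t2). pose proof (Rmax_r t1 t2).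
      specialize (H1 (RtoC X) ltac:(simpl; lra)). specialize (H2 (RtoC X) ltac:(simpl; lra)).
      pose proof (Cmod_triangle (f X - INR d * X) (- (f X - INR c * X)))%C as T.
      rewrite Cmod_opp in T.
      replace (f X - INR d * X + - (f X - INR c * X))%C with (RtoC ((INR c - INR d) * X)) in T.
      2: { rewrite RtoC_mult, RtoC_minus. ring. }
      rewrite Cmod_R, Rabs_mult, (Rabs_pos_eq X) in T by lra.
      apply Rle_div_r; lra. }
  apply Rabs_eq_0. pose proof (Rabs_pos (INR c - INR d)). lra.
Qed.

Lemma asymptotic_slope_comp (f g h : C -> C) (c d : nat) :
  (1 <= d)%nat -> asymptotic_slope f c -> asymptotic_slope g d ->
  (forall s, half_plane 0 s -> f (g s) = h s) -> asymptotic_slope h (c * d).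
Proof.
  intros Hd (t1 & M1 & Ht1 & HM1 & H1) (t2 & M2 & Ht2 & HM2 & H2) Hh.
  (* As $d\ge1$, $\operatorname{Re}g(s)\ge\operatorname{Re}s-M_2\ge t_1$, so [g s] lies where the
     estimate for [f] holds. *)
  exists (t1 + t2 + M2), (M1 + INR c * M2).
  pose proof (pos_INR c) as Hc.
  apply le_INR in Hd. simpl in Hd.
  split; [lra|]. split; [nra|]. intros s Hs.
  specialize (H2 s ltac:(lra)).
  assert (Hg : t1 <= Re (g s)).
  { pose proof (re_le_Cmod (g s - INR d * s)%C) as T. apply Rabs_le_between in T.
    replace (Re (g s - INR d * s)%C) with (Re (g s) - INR d * Re s) in T
      by (unfold Re, RtoC, Cminus, Copp, Cplus, Cmult; simpl; ring).
    nra. }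
  specialize (H1 (g s) Hg). rewrite <- Hh by (unfold half_plane; lra).
  replace (f (g s) - INR (c * d) * s)%C
    with ((f (g s) - INR c * g s) + INR c * (g s - INR d * s))%C
    by (rewrite mult_INR, RtoC_mult; ring).
  eapply Rle_trans; [apply Cmod_triangle|].
  rewrite Cmod_mult, Cmod_R, (Rabs_pos_eq (INR c)) by exact Hc.
  apply Rplus_le_compat; [exact H1|]. apply Rmult_le_compat_l; assumption.
Qed.

Lemma dirichlet_perturbation_slope (f phi : C -> C) (c : nat) :
  in_dirichlet_class 0 phi ->
  (forall s, half_plane 0 s -> f s = (RtoC (INR c) * s + phi s)%C) ->
  asymptotic_slope f c.
Proof.
  intros Hphi Hf.
  destruct (dirichlet_asymptotic phi Hphi) as (a1 & K & X0 & HK & HX0 & H).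
  exists X0, (Cmod a1 + K). pose proof (Cmod_ge_0 a1).
  split; [lra|]. split; [lra|]. intros s Hs.
  rewrite Hf by (unfold half_plane; lra).
  replace (INR c * s + phi s - INR c * s)%C with (a1 + (phi s - a1))%C by ring.
  eapply Rle_trans; [apply Cmod_triangle|]. apply Rplus_le_compat_l.
  eapply Rle_trans; [apply H; exact Hs|]. apply div_sqr_le; lra.
Qed.

(** * Multiplicativity of the slopes along the semigroup *)

Section Semigroup.

Variable Phi : R -> C -> C.
Hypothesis HPhi : continuous_semigroup_in_G Phi.

(** Slope 0 would force $\operatorname{Re}\Phi_t(1/4)>1/2$, but for small $t$ the point
    $\Phi_t(1/4)$ is within $1/4$ of $1/4$. *)
Lemma semigroup_small_slope :
  exists delta : R, 0 < delta /\ forall t, 0 < t < delta ->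
    exists c, (1 <= c)%nat /\ asymptotic_slope (Phi t) c.
Proof.
  destruct HPhi as (HG & H0 & _ & Hc).
  destruct (Hc (fun z => z = RtoC (/ 4))) with (eps := / 4) as (delta & Hd & H).
  - intros I U _ HU. destruct (HU (RtoC (/ 4)) eq_refl) as [i Hi].
    exists (i :: nil)%list. intros z ->. exists i. split; [now left|exact Hi].
  - intros s ->. unfold half_plane. simpl. lra.
  - lra.
  - exists delta. split; [exact Hd|]. intros t Ht.
    destruct (HG t ltac:(lra)) as (_ & _ & c & phi & Hphi & Hf & Hc0).
    exists c. split; [|now apply (dirichlet_perturbation_slope _ phi)].
    destruct c as [|c]; [exfalso|lia].
    specialize (H t Ht _ eq_refl).
    assert (Hp : half_plane 0 (RtoC (/ 4))) by (unfold half_plane; simpl; lra).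
    specialize (Hc0 eq_refl _ Hp). unfold half_plane in Hc0.
    rewrite H0 in H by exact Hp.
    pose proof (re_le_Cmod (Phi t (RtoC (/ 4)) - RtoC (/ 4))%C) as T.
    apply Rabs_le_between in T.
    replace (Re (Phi t (RtoC (/ 4)) - RtoC (/ 4))%C) with (Re (Phi t (RtoC (/ 4))) - / 4) in T
      by (unfold Re, RtoC, Cminus, Copp, Cplus; simpl; ring).
    lra.
Qed.

Lemma semigroup_slope_pow (t : R) (c : nat) :
  0 <= t -> (1 <= c)%nat -> asymptotic_slope (Phi t) c ->
  forall n, asymptotic_slope (Phi (INR n * t)) (c ^ n).
Proof.
  intros Ht Hc H. destruct HPhi as (_ & H0 & Hadd & _).
  induction n as [|n IH].
  - simpl INR. rewrite Rmult_0_l. exists 1, 0. split; [lra|]. split; [lra|].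
    intros s Hs. rewrite H0 by (unfold half_plane; lra). simpl.
    replace (s - 1 * s)%C with (RtoC 0) by ring. rewrite Cmod_0. lra.
  - apply (asymptotic_slope_comp (Phi t) (Phi (INR n * t))).
    + apply Nat.neq_0_lt_0, Nat.pow_nonzero. lia.
    + exact H.
    + exact IH.
    + intros s Hs. rewrite Hadd; auto.
      * f_equal. rewrite S_INR. ring.
      * apply Rmult_le_pos; [apply pos_INR|exact Ht].
Qed.

(* The slope at time 1 is an [n]-th power for all large [n], hence 1. *)
Lemma semigroup_time_one :
  exists phi, in_dirichlet_class 0 phi /\
    forall s, half_plane 0 s -> Phi 1 s = (s + phi s)%C.
Proof.
  destruct (proj1 HPhi 1 ltac:(lra)) as (_ & _ & c & phi & Hphi & Hf & _).
  exists phi. split; [exact Hphi|].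
  assert (Hc : c = 1%nat).
  { pose proof (dirichlet_perturbation_slope _ _ _ Hphi Hf) as Hs.
    destruct semigroup_small_slope as (delta & Hd & Hsm).
    destruct (INR_unbounded (/ delta)) as [m Hm].
    (* Large enough for $1/n<\delta$ and for $n>c$; then $d\ge2$ would give $c=d^n>n>c$. *)
    set (n := S (m + c)).
    assert (Hn : 0 < / INR n < delta).
    { assert (Hmn : INR m <= INR n) by (apply le_INR; unfold n; lia).
      assert (0 < / delta) by now apply Rinv_0_lt_compat.
      split; [apply Rinv_0_lt_compat; lra|].
      rewrite <- (Rinv_inv delta). apply Rinv_lt_contravar; [|lra].
      apply Rmult_lt_0_compat; lra. }
    destruct (Hsm _ Hn) as (d & Hd1 & Hds).
    pose proof (semigroup_slope_pow (/ INR n) d ltac:(lra) Hd1 Hds n) as Hp.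
    rewrite Rinv_r in Hp.
    2: { intros E. rewrite E, Rinv_0 in Hn. lra. }
    pose proof (asymptotic_slope_unique _ _ _ Hs Hp) as Hcd.
    destruct (Nat.eq_dec d 1) as [->|Hd2].
    - rewrite Nat.pow_1_l in Hcd. exact Hcd.
    - exfalso. assert (n < d ^ n)%nat by (apply Nat.pow_gt_lin_r; lia).
      unfold n in *. lia. }
  intros s Hs. rewrite (Hf s Hs), Hc. simpl INR. now rewrite Cmult_1_l.
Qed.

End Semigroup.

(** * The displacement $\Phi_1(s)-s$: nonnegative real part and rigidity *)

Lemma holomorphic_Re_zero_constant (f : C -> C) :
  holomorphic_on (half_plane 0) f -> (forall s, half_plane 0 s -> Re (f s) = 0) ->
  forall s, half_plane 0 s -> f s = (0, Im (f (RtoC 1))).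
Proof.
  intros Hf H0.
  assert (HD : forall x y, 0 < x ->
     differentiable_pt_lim (fun u v => Im (f (u, v))) x y 0 0).
  { intros x y Hx. destruct (Hf (x, y) Hx) as [l Hl].
    apply is_C_derive_differentiable in Hl. destruct Hl as [H1 H2].
    (* The real part vanishes near the point, so $l=0$ and both partials of the imaginary part
       vanish. *)
    assert (H3 : differentiable_pt_lim (fun _ _ => 0) x y (Re l) (- Im l)).
    { apply (differentiable_pt_lim_ext (fun u v => Re (f (u, v)))); [|exact H1].
      exists (mkposreal x Hx). intros u v Hu _. simpl in Hu. apply H0.
      unfold half_plane. simpl. apply Rabs_def2 in Hu. lra. }
    apply differentiable_pt_lim_unique in H3. rewrite !Derive_const in H3.
    destruct H3 as [H3 H4]. rewrite <- H3 in H2.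
    replace (Im l) with 0 in H2 by lra. exact H2. }
  intros [x y] Hs. unfold half_plane in Hs. simpl in Hs.
  pose proof (H0 (x, y) Hs) as HR.
  rewrite (surjective_pairing (f (x, y))).
  change (fst (f (x, y))) with (Re (f (x, y))). change (snd (f (x, y))) with (Im (f (x, y))).
  rewrite HR. f_equal.
  (* The segment from 1 to $s$ stays in the half-plane by convexity. *)
  set (h := fun t => Im (f (1 + t * (x - 1), t * y))).
  assert (Hh : forall t, 0 <= t <= 1 -> is_derive h t 0).
  { intros t Ht. apply is_derive_Reals.
    replace 0 with (0 * (x - 1) + 0 * y) by ring.
    apply (derivable_pt_lim_comp_2d (fun u v => Im (f (u, v)))
      (fun t => 1 + t * (x - 1)) (fun t => t * y)).
    - apply HD. nra.
    - apply is_derive_Reals. auto_derive; auto. ring.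
    - apply is_derive_Reals. auto_derive; auto. ring. }
  destruct (MVT_gen h 0 1 (fun _ => 0)) as (c & _ & E).
  - intros t. rewrite Rmin_left, Rmax_right by lra. intros Ht. apply Hh. lra.
  - intros t. rewrite Rmin_left, Rmax_right by lra. intros Ht. apply continuity_pt_filterlim.
    apply (ex_derive_continuous (K := R_AbsRing) (V := R_NormedModule) h).
    exists 0. now apply Hh.
  - unfold h in E. rewrite !Rmult_0_l, Rmult_1_l, Rplus_0_r in E.
    replace (1 + (x - 1)) with x in E by ring. rewrite Rmult_1_l in E.
    change (1, 0) with (RtoC 1) in E. lra.
Qed.

Lemma vertical_translation_automorphism (f : C -> C) (b : R) :
  holomorphic_on (half_plane 0) f ->
  (forall s, half_plane 0 s -> f s = (s + (0, b))%C) -> automorphism f.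
Proof.
  intros Hf H.
  assert (Hmap : forall b s, half_plane 0 s -> half_plane 0 (s + (0, b))%C).
  { intros b' [x y]. unfold half_plane. simpl. lra. }
  split; [exact Hf|]. split.
  { intros s Hs. rewrite H by exact Hs. now apply Hmap. }
  exists (fun s => (s + (0, (- b)%R))%C). repeat split.
  - intros s _. eexists. apply is_C_derive_plus; [apply is_C_derive_id|apply is_C_derive_const].
  - intros s Hs. now apply Hmap.
  - intros [x y] Hs. rewrite H by exact Hs. unfold Cplus. simpl. f_equal; ring.
  - intros [x y] Hs. rewrite H by now apply Hmap. unfold Cplus. simpl. f_equal; ring.
Qed.

(* [Re phi >= 0] is Julia's lemma at infinity: [Re f (x + iy) / x] is nonincreasing
   and tends to 1. *)
Lemma displacement_Re_nonneg (f phi : C -> C) :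
  holomorphic_on (half_plane 0) f -> maps_into (half_plane 0) (half_plane 0) f ->
  in_dirichlet_class 0 phi ->
  (forall s, half_plane 0 s -> f s = (s + phi s)%C) ->
  forall s, half_plane 0 s -> 0 <= Re (phi s).
Proof.
  intros Hf Hm Hphi H [x y] Hs. unfold half_plane in Hs. simpl in Hs.
  destruct (dirichlet_asymptotic phi Hphi) as (a1 & K & X0 & HK & HX0 & HA).
  pose proof (Cmod_ge_0 a1) as Ha.
  cut (- Re (phi (x, y)) <= 0); [lra|].
  apply (le_0_of_le_div _ (x * (Cmod a1 + K)) (Rmax X0 x)).
  - nra.
  - pose proof (Rmax_l X0 x). lra.
  - intros X HX. pose proof (Rmax_l X0 x). pose proof (Rmax_r X0 x).
    destruct (Harnack f x X y Hf) as [HH _]; try lra.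
    { intros s' Hs'. left. exact (Hm s' Hs'). }
    (* The products $xX$ cancel in Harnack's inequality: $x\operatorname{Re}\varphi(X+iy)\le
       X\operatorname{Re}\varphi(x+iy)$, with $\varphi$ bounded far to the right. *)
    rewrite !H in HH by (unfold half_plane; simpl; lra).
    replace (Re ((X, y) + phi (X, y))%C) with (X + Re (phi (X, y))) in HH by reflexivity.
    replace (Re ((x, y) + phi (x, y))%C) with (x + Re (phi (x, y))) in HH by reflexivity.
    assert (B : Cmod (phi (X, y)) <= Cmod a1 + K).
    { replace (phi (X, y)) with (a1 + (phi (X, y) - a1))%C by ring.
      eapply Rle_trans; [apply Cmod_triangle|]. apply Rplus_le_compat_l.
      eapply Rle_trans; [apply HA; simpl; lra|]. simpl Re. apply div_sqr_le; lra. }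
    pose proof (re_le_Cmod (phi (X, y))) as T.
    assert (T2 : - (Cmod a1 + K) <= Re (phi (X, y))).
    { apply Rabs_le_between in T. lra. }
    apply Rle_div_r; [lra|]. nra.
Qed.

(* [x Re phi (x + iy)] is nondecreasing while [phi = a1 + O(x^-2)]. *)
Lemma displacement_Re_zero (phi : C -> C) (a1 : C) (K X0 : R) :
  holomorphic_on (half_plane 0) phi ->
  (forall s, half_plane 0 s -> 0 <= Re (phi s)) ->
  0 <= K -> 1 <= X0 ->
  (forall s, X0 <= Re s -> Cmod (phi s - a1)%C <= K / Re s ^ 2) ->
  Re a1 <= 0 ->
  forall s, half_plane 0 s -> Re (phi s) = 0.
Proof.
  intros Hh Hpos HK HX0 HA Ha [x y] Hs. pose proof (Hpos _ Hs) as Hp.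
  unfold half_plane in Hs. simpl in Hs.
  apply Rle_antisym; [|exact Hp].
  cut (x * Re (phi (x, y)) <= 0); [nra|].
  apply (le_0_of_le_div _ K (Rmax X0 x)).
  - exact HK.
  - pose proof (Rmax_l X0 x). lra.
  - intros X HX. pose proof (Rmax_l X0 x). pose proof (Rmax_r X0 x).
    destruct (Harnack phi x X y Hh Hpos) as [_ HH]; try lra.
    specialize (HA (X, y) ltac:(simpl; lra)). simpl Re in HA.
    pose proof (re_le_Cmod (phi (X, y) - a1)%C) as T.
    change (Re (phi (X, y) - a1)%C) with (Re (phi (X, y)) - Re a1) in T.
    apply Rabs_le_between in T.
    assert (T2 : Re (phi (X, y)) <= K / X ^ 2) by lra.
    apply (Rmult_le_compat_l X) in T2; [|lra].
    replace (X * (K / X ^ 2)) with (K / X) in T2 by (field; lra). lra.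
Qed.

(** * Linear growth of the orbit and vanishing of the hyperbolic step *)

Theorem proposition6p10 :
  forall Phi : R -> C -> C,
    continuous_semigroup_in_G Phi ->
    (forall t : R, 0 < t -> ~ automorphism (Phi t)) ->
    zero_hyperbolic_step Phi.
Proof.
  intros Phi HPhi Hna.
  destruct (semigroup_time_one Phi HPhi) as (phi & Hphi & Hf).
  destruct HPhi as (HG & Hid & Hadd & _).
  assert (Hmaps : forall t s, 0 <= t -> half_plane 0 s -> half_plane 0 (Phi t s)).
  { intros t s Ht. apply (HG t Ht). }
  assert (Hhol : holomorphic_on (half_plane 0) (Phi 1)) by (apply HG; lra).
  assert (Hpos : forall s, half_plane 0 s -> 0 <= Re (phi s)).
  { apply (displacement_Re_nonneg (Phi 1)); auto. intros s. apply Hmaps. lra. }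
  destruct (dirichlet_asymptotic phi Hphi) as (a1 & K & X0 & HK & HX0 & HA).
  (* Otherwise [phi] is an imaginary constant and [Phi 1] is a vertical translation, hence an
     automorphism. *)
  assert (Ha : 0 < Re a1).
  { apply Rnot_le_lt. intros Ha. apply (Hna 1 ltac:(lra)).
    apply (vertical_translation_automorphism _ (Im (phi (RtoC 1))) Hhol).
    intros s Hs. rewrite (Hf s Hs). f_equal.
    apply (holomorphic_Re_zero_constant phi (proj1 Hphi)); [|exact Hs].
    apply (displacement_Re_zero phi a1 K X0); auto. apply Hphi. }
  (* Beyond [X1] the error $K/(\operatorname{Re}s)^2$ is at most half of $\operatorname{Re}a_1$. *)
  set (X1 := X0 + 2 * K / Re a1).
  assert (HX1 : X0 <= X1).
  { assert (0 <= 2 * K / Re a1) by (apply Rdiv_le_0_compat; lra). unfold X1. lra. }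
  assert (Hfar : forall s, X1 <= Re s -> Re a1 / 2 <= Re (phi s)).
  { intros s Hs. specialize (HA s ltac:(lra)).
    pose proof (re_le_Cmod (phi s - a1)%C) as T.
    change (Re (phi s - a1)%C) with (Re (phi s) - Re a1) in T.
    apply Rabs_le_between in T.
    assert (K / Re s ^ 2 <= Re a1 / 2); [|lra].
    apply Rle_div_l; [nra|].
    assert (HKs : 2 * K <= Re s * Re a1).
    { apply Rle_trans with (X1 * Re a1); [|nra].
      unfold X1. replace ((X0 + 2 * K / Re a1) * Re a1) with (X0 * Re a1 + 2 * K) by (field; lra). nra. }
    nra. }
  assert (Hgrow : forall x0, 0 < x0 -> exists delta, 0 < delta /\
     forall s, x0 <= Re s -> delta <= Re (phi s)).
  { intros x0 Hx0. exists (Rmin 1 (x0 / X1) * (Re a1 / 2)).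
    assert (Hq : 0 < x0 / X1) by (apply Rdiv_lt_0_compat; lra).
    split.
    { apply Rmult_lt_0_compat; [apply Rmin_pos; lra|lra]. }
    intros [x y] Hs. simpl in Hs.
    destruct (Rle_dec X1 x) as [Hx|Hx].
    - pose proof (Hfar (x, y) Hx). pose proof (Rmin_l 1 (x0 / X1)). nra.
    - destruct (Harnack phi x X1 y (proj1 Hphi) Hpos) as [HH _]; try lra.
      pose proof (Hfar (X1, y) ltac:(simpl; lra)).
      pose proof (Rmin_r 1 (x0 / X1)).
      apply Rle_trans with (x0 / X1 * (Re a1 / 2)); [nra|].
      apply (Rmult_le_reg_l X1); [lra|].
      replace (X1 * (x0 / X1 * (Re a1 / 2))) with (x0 * (Re a1 / 2)) by (field; lra).
      nra. }
  assert (Hnofix : no_fixed_points Phi).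
  { intros s Hs Hfix. destruct (Hgrow (Re s) Hs) as (delta & Hd & Hg).
    specialize (Hg s ltac:(lra)). specialize (Hfix 1 ltac:(lra)).
    rewrite (Hf s Hs) in Hfix. apply (f_equal Re) in Hfix.
    change (Re (s + phi s)%C) with (Re s + Re (phi s)) in Hfix. lra. }
  split; [exact Hnofix|].
  intros (_ & s0 & l & Hs0 & Hl & Hlim).
  destruct (Hgrow (Re s0) Hs0) as (delta & Hd & Hg).
  set (z := fun n => Phi (INR n) s0).
  assert (HzS : forall n, Phi (INR n + 1)%R s0 = (z n + phi (z n))%C).
  { intros n. pose proof (pos_INR n). rewrite Rplus_comm, <- Hadd by (auto; lra).
    apply Hf. apply Hmaps; auto. }
  (* Each unit of time adds at least [delta], since the orbit never leaves the half-plane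
     $\operatorname{Re}s\ge\operatorname{Re}s_0$ at integer times. *)
  assert (Hz : forall n, Re s0 + INR n * delta <= Re (z n)).
  { induction n as [|n IH].
    - simpl INR. unfold z. simpl INR. rewrite (Hid s0 Hs0). lra.
    - unfold z at 1. rewrite S_INR, HzS.
      change (Re (z n + phi (z n))%C) with (Re (z n) + Re (phi (z n))).
      pose proof (pos_INR n). specialize (Hg (z n) ltac:(nra)). lra. }
  set (B := Cmod a1 + K).
  (* The pseudohyperbolic step: the numerator is $|\varphi(z_n)|\le B$ for large $n$ and the
     denominator is at least $n\delta$. *)
  set (rho := fun n => Cmod (z n - Phi (INR n + 1)%R s0)%C / Cmod (z n + Cconj (Phi (INR n + 1)%R s0))%C).
  assert (Hrho : is_lim_seq rho 0).
  { apply (is_lim_seq_le_le_loc (fun _ => 0) _ (fun n => B / delta * / INR n)).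
    (* From this [N] on the orbit is to the right of [X0], where $\varphi$ is bounded; the successor
       also ensures $n\ge1$. *)
    - destruct (INR_unbounded (X0 / delta)) as [N HN]. exists (S N). intros n Hn.
      assert (HNn : INR N <= INR n) by (apply le_INR; lia).
      assert (Hn1 : 1 <= INR n) by (apply (le_INR 1); lia).
      assert (HX : X0 <= INR n * delta).
      { apply Rlt_div_l in HN; [nra|exact Hd]. }
      specialize (Hz n). unfold half_plane in Hs0.
      assert (HB : Cmod (phi (z n)) <= B).
      { replace (phi (z n)) with (a1 + (phi (z n) - a1))%C by ring.
        eapply Rle_trans; [apply Cmod_triangle|]. apply Rplus_le_compat_l.
        eapply Rle_trans; [apply HA; lra|]. apply div_sqr_le; lra. }
      assert (Hden : INR n * delta <= Cmod (z n + Cconj (Phi (INR n + 1)%R s0))%C).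
      { eapply Rle_trans; [|apply re_le_Cmod]. eapply Rle_trans; [|apply Rle_abs].
        rewrite HzS.
        change (Re (z n + Cconj (z n + phi (z n)))%C) with (Re (z n) + (Re (z n) + Re (phi (z n)))).
        specialize (Hg (z n) ltac:(nra)). nra. }
      assert (Hnum : Cmod (z n - Phi (INR n + 1)%R s0)%C <= B).
      { rewrite HzS. replace (z n - (z n + phi (z n)))%C with (- phi (z n))%C by ring.
        now rewrite Cmod_opp. }
      assert (Hnd : 0 < INR n * delta) by nra.
      unfold rho. split.
      + apply Rdiv_le_0_compat; [apply Cmod_ge_0|lra].
      + replace (B / delta * / INR n) with (B / (INR n * delta)) by (field; lra).
        unfold Rdiv. apply Rmult_le_compat; [apply Cmod_ge_0| | exact Hnum|].
        * left. apply Rinv_0_lt_compat. lra.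
        * apply Rinv_le_contravar; assumption.
    - apply is_lim_seq_const.
    - replace (Finite 0) with (Rbar_mult (B / delta) 0) by (simpl; f_equal; ring).
      apply is_lim_seq_scal_l.
      apply (is_lim_seq_inv INR p_infty); [apply is_lim_seq_INR|discriminate]. }
  (* The assumed positive limit, restricted to integer times, contradicts the limit 0 in [L2]. *)
  assert (L1 : is_lim_seq (fun n => hyperbolic_dist (z n) (Phi (INR n + 1)%R s0)) l).
  { apply (is_lim_comp_seq (fun t => hyperbolic_dist (Phi t s0) (Phi (t + 1) s0)) INR p_infty l Hlim).
    - exists 0%nat. discriminate.
    - apply is_lim_seq_INR. }
  assert (L2 : is_lim_seq (fun n => hyperbolic_dist (z n) (Phi (INR n + 1)%R s0)) 0).
  (* The distance is [h] of the pseudohyperbolic step, and [h] is continuous at 0 with $h(0)=0$. *)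
  { set (h := fun r => / 2 * ln ((1 + r) / (1 - r))).
    assert (E : Finite 0 = h 0).
    { unfold h. replace ((1 + 0) / (1 - 0)) with 1 by field. rewrite ln_1. f_equal. ring. }
    rewrite E. apply (is_lim_seq_continuous h rho 0); [|exact Hrho].
    apply continuity_pt_filterlim.
    apply (ex_derive_continuous (K := R_AbsRing) (V := R_NormedModule) h).
    unfold h. auto_derive. split; [lra|]. split; [|auto].
    replace ((1 + 0) * / (1 + - 0)) with 1 by field. lra. }
  apply is_lim_seq_unique in L1. apply is_lim_seq_unique in L2.
  rewrite L1 in L2. injection L2 as L2. lra.
Qed.
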